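(* For every integer $r\geq 2$ there is a $\mathbb{Z}_{2r}$-invariant triangulation $P_{12r+3}(r)$ of the prism space $P(r)$ with $f$-vector $$f(P_{12r+3}(r))=(12r+3,\;84r+3,\;144r,\;72r).$$
   Context: A triangulation of a closed $3$-manifold $M$ is a finite (abstract) simplicial complex whose geometric realization is homeomorphic to $M$. Its $f$-vector is $(f_0,f_1,f_2,f_3)$, where $f_i$ is the number of $i$-dimensional faces. A triangulation is $\mathbb{Z}_{2r}$-invariant if the cyclic group $\mathbb{Z}_{2r}$ of order $2r$ acts effectively on it by simplicial automorphisms. For $r\ge 2$ the prism space $P(r)$ is the Seifert manifold $\{Oo,0\mid -1;(2,1),(2,1),(r,1)\}$, defined as follows. Take a $2$-sphere with four disjoint open discs removed, with boundary circles $Q_0,Q_1,Q_2,Q_3$, form the product with $S^1$, and let $H_i$ be an $S^1$-fiber on the boundary torus containing $Q_i$. Glue solid tori to the four boundary tori so that the meridians are the simple closed curves homotopic to $Q_0-H_0$, $2Q_1+H_1$, $2Q_2+H_2$, and $rQ_3+H_3$, respectively. Equivalently, $P(r)$ is the quotient $S^3/D_r^*$ of the Lie group $S^3\cong SU(2)$ with respect to (left or right) multiplication by its finite subgroup $D^*_r=\langle x,y\mid x^2=(xy)^2=y^r\rangle$, the binary dihedral group of order $4r$. Geometrically, $P(r)$ is obtained from a solid prism over a regular $2r$-gon by identifying the top and bottom sides under a twist of $\pi/r$ and identifying opposite square side faces after a twist of $\pi/2$; the $\mathbb{Z}_{2r}$-action is the one induced by rotating the prism about its axis. *)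

(* Defs.v *)
From HB Require Import structures.
From mathcomp Require Import all_boot all_order all_algebra all_fingroup.
From mathcomp Require Import generic_quotient ring lra.
From mathcomp Require Import all_classical all_reals all_analysis.
Import Order.TTheory GRing.Theory Num.Theory.
Import numFieldNormedType.Exports.

Set Implicit Arguments.
Unset Strict Implicit.
Unset Printing Implicit Defensive.

Local Open Scope classical_set_scope.
Local Open Scope ring_scope.

Definition homeomorphism (X Y : topologicalType) (h : X -> Y) : Prop :=
  exists g : Y -> X, [/\ cancel h g, cancel g h, continuous h & continuous g].

Section SimplicialComplexes.
Variable V : finType.
Implicit Type K : {set {set V}}.

(* The faces are the nonempty ones, and every element of V is a vertex. *)
Definition simplicial_complex K : Prop :=
  [/\ finset.set0 \notin K,
      forall v, [set v]%SET \in K &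
      forall s t : {set V}, s \in K -> t \subset s -> t != finset.set0 ->
        t \in K].

Definition face_count K (i : nat) : nat :=
  #|[set s : {set V} in K | #|s| == i.+1]%SET|.

Definition fvector K : seq nat := [seq face_count K i | i <- iota 0 4].

(* The geometric realization in barycentric coordinates, with the topology
   induced by R^V. *)
Definition realization (R : realType) (K : {set {set V}}) :
    set (prod_topology (fun _ : V => R)) :=
  [set p | [/\ forall v, 0 <= p v, \sum_v p v = 1 &
               [set v | p v != 0]%SET \in K]].
Arguments realization R K : clear implicits.

(* The cyclic group of order n is the additive group 'Z_n (for n > 1). *)
Definition simplicial_action K (n : nat) (to : {action 'Z_n &-> V}) : Prop :=
  forall (a : 'Z_n) (s : {set V}), s \in K -> [set to v a | v in s]%SET \in K.

(* Since every element of V is a vertex, this is effectiveness of the action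
   on the complex. *)
Definition effective_action (n : nat) (to : {action 'Z_n &-> V}) : Prop :=
  [faithful [set: 'Z_n]%SET, on [set: V]%SET | to].

(* q is the image of p under the map of realizations induced by a
   permutation s of the vertices. *)
Definition vertex_image (R : realType) K (s : V -> V)
    (p q : realization R K) : Prop :=
  forall v, \val q (s v) = \val p v.

End SimplicialComplexes.
Arguments realization {V} R K.

Section Sphere.
Variable R : realType.

(* (a, b, c, d) is the quaternion a + b i + c j + d k. *)
Definition quaternion : Type := (R * R * R * R)%type.

Definition qmul (p q : quaternion) : quaternion :=
  let: (a, b, c, d) := p in
  let: (a', b', c', d') := q in
  (a * a' - b * b' - c * c' - d * d',
   a * b' + b * a' + c * d' - d * c',
   a * c' - b * d' + c * a' + d * b',
   a * d' + b * c' - c * b' + d * a').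

Definition qconj (q : quaternion) : quaternion :=
  let: (a, b, c, d) := q in (a, - b, - c, - d).

Definition qnorm2 (q : quaternion) : R :=
  let: (a, b, c, d) := q in a ^+ 2 + b ^+ 2 + c ^+ 2 + d ^+ 2.

Definition unit_quaternions : set (R * R * R * R)%type :=
  [set q | qnorm2 q = 1].

(* The Lie group SU(2) as the group of unit quaternions, with the topology
   induced by R^4. *)
Definition S3 : Type := set_type unit_quaternions.
HB.instance Definition _ := Topological.on S3.

Lemma qnorm2M p q : qnorm2 (qmul p q) = qnorm2 p * qnorm2 q.
Proof.
by case: p => [[[a b] c] d]; case: q => [[[a' b'] c'] d'] /=; ring.
Qed.

Lemma S3_norm (p : S3) : qnorm2 (\val p) = 1.
Proof. exact: (set_mem (valP p)). Qed.

Definition mkS3 q (hq : qnorm2 q = 1) : S3 := exist _ q (mem_set hq).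

Lemma S3_mul_subproof (p q : S3) : qnorm2 (qmul (\val p) (\val q)) = 1.
Proof. by rewrite qnorm2M !S3_norm mulr1. Qed.

Lemma S3_inv_subproof (p : S3) : qnorm2 (qconj (\val p)) = 1.
Proof.
rewrite -[RHS](S3_norm p); case: (\val p) => [[[a b] c] d] /=.
by rewrite !sqrrN.
Qed.

Lemma S3_one_subproof : qnorm2 ((1, 0, 0, 0) : quaternion) = 1.
Proof. by rewrite /=; ring. Qed.

Definition S3_one : S3 := mkS3 S3_one_subproof.
Definition S3_mul (p q : S3) : S3 := mkS3 (S3_mul_subproof p q).
Definition S3_inv (p : S3) : S3 := mkS3 (S3_inv_subproof p).

Lemma S3_mulA : associative S3_mul.
Proof.
move=> [p hp] [q hq] [s hs]; apply: val_inj => /= {hp hq hs}.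
case: p => [[[a b] c] d]; case: q => [[[a' b'] c'] d'].
by case: s => [[[a1 b1] c1] d1] /=; congr (_, _, _, _); ring.
Qed.

Lemma S3_mul1l : left_id S3_one S3_mul.
Proof.
move=> [[[[a b] c] d] h]; apply: val_inj => /=.
by congr (_, _, _, _); ring.
Qed.

Lemma S3_mul1r : right_id S3_one S3_mul.
Proof.
move=> [[[[a b] c] d] h]; apply: val_inj => /=.
by congr (_, _, _, _); ring.
Qed.

Lemma S3_mulVl : left_inverse S3_one S3_inv S3_mul.
Proof.
move=> p; have := S3_norm p; case: p => [[[[a b] c] d] h] /= e.
by apply: val_inj => /=; congr (_, _, _, _); first rewrite -e; ring.
Qed.

Lemma S3_mulVr : right_inverse S3_one S3_inv S3_mul.
Proof.
move=> p; have := S3_norm p; case: p => [[[[a b] c] d] h] /= e.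
by apply: val_inj => /=; congr (_, _, _, _); first rewrite -e; ring.
Qed.

HB.instance Definition _ :=
  isGroup.Build S3 S3_mulA S3_mul1l S3_mul1r S3_mulVl S3_mulVr.

Lemma qnorm2_expi (t : R) : qnorm2 ((cos t, sin t, 0, 0) : quaternion) = 1.
Proof. by rewrite /= -[RHS](cos2Dsin2 t); ring. Qed.

Lemma qnorm2_j : qnorm2 ((0, 0, 1, 0) : quaternion) = 1.
Proof. by rewrite /=; ring. Qed.

(* exp(t i) = cos t + (sin t) i *)
Definition expi (t : R) : S3 := mkS3 (qnorm2_expi t).
Definition quat_j : S3 := mkS3 qnorm2_j.

End Sphere.

Section Generated.
Local Open Scope group_scope.
Variable G : groupType.

Inductive generated (A : set G) : set G :=
| generated_in g of A g : generated A g
| generated_1 : generated A 1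
| generated_M g h of generated A g & generated A h : generated A (g * h)
| generated_V g of generated A g : generated A g^-1.

(* p and q lie in the same right coset of the subgroup generated by A. *)
Definition same_coset (A : set G) (p q : G) : bool :=
  `[< exists2 g, generated A g & q = g * p >].

Lemma same_coset_refl A : reflexive (same_coset A).
Proof.
by move=> p; apply/asboolP; exists 1; [exact: generated_1|rewrite mul1g].
Qed.

Lemma same_coset_sym A : symmetric (same_coset A).
Proof.
have H p q : same_coset A p q -> same_coset A q p.
  move/asboolP=> [g gA ->]; apply/asboolP; exists g^-1.
    exact: generated_V.
  by rewrite mulKg.
by move=> p q; apply/idP/idP => /H.
Qed.

Lemma same_coset_trans A : transitive (same_coset A).
Proof.
move=> q p s /asboolP[g gA ->] /asboolP[h hA ->]; apply/asboolP.
by exists (h * g); [exact: generated_M|rewrite mulgA].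
Qed.

Canonical same_coset_equiv A : equiv_rel G :=
  EquivRel (same_coset A) (@same_coset_refl A) (@same_coset_sym A)
    (@same_coset_trans A).

End Generated.

Section PrismSpace.
Variables (R : realType) (r : nat).
Local Open Scope group_scope.
Local Open Scope quotient_scope.

(* The binary dihedral group is realized in S3 with x = j and
   y = exp(pi i / r). *)
Definition dstar_x : S3 R := quat_j R.
Definition dstar_y : S3 R := expi (pi / r%:R)%R.

Definition dstar_gens : set (S3 R) := [set dstar_x; dstar_y].

Lemma dstar_relations : (0 < r)%N ->
  dstar_x ^+ 2 = (dstar_x * dstar_y) ^+ 2 /\ dstar_x ^+ 2 = dstar_y ^+ r.
Proof.
move=> r0.
have yn n : dstar_y ^+ n = expi (n%:R * (pi / r%:R))%R.
  elim: n => [|n IHn].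
    by apply: val_inj; rewrite /= mul0r cos0 sin0.
  rewrite expgS IHn; apply: val_inj => /=.
  rewrite -[n.+1%:R]natr1 [((_ + 1) * _)%R]mulrDl mul1r cosD sinD.
  by congr (_, _, _, _); ring.
have xx : \val (dstar_x ^+ 2) = ((-1, 0, 0, 0)%R : quaternion R).
  by rewrite /expgn /= /dstar_x /=; congr (_, _, _, _); ring.
split; apply: val_inj; rewrite xx.
  rewrite expg2 /=; have := cos2Dsin2 (pi / r%:R : R)%R.
  set c := cos _; set s := sin _ => cs.
  by congr (_, _, _, _); [transitivity (- (c ^+ 2 + s ^+ 2))%R; first rewrite cs|..]; ring.
rewrite yn /= mulrC divfK; last by rewrite pnatr_eq0 -lt0n.
by rewrite cospi sinpi.
Qed.

(* S^3 / D_r^* with respect to left multiplication *)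
Definition prism_space : Type :=
  quotient_topology {eq_quot (same_coset_equiv dstar_gens)}.
HB.instance Definition _ := Topological.on prism_space.
HB.instance Definition _ := Quotient.on prism_space.

Lemma prism_space_eqP (p q : S3 R) :
  \pi_prism_space p = \pi_prism_space q <->
  exists2 g, generated dstar_gens g & q = g * p.
Proof.
have -> : (\pi_prism_space p = \pi_prism_space q) =
    (p = q %[mod {eq_quot (same_coset_equiv dstar_gens)}]) by [].
split=> [/eqmodP/asboolP //|pq]; exact/eqmodP/asboolP.
Qed.

(* The points of S3 at least as close to 1 as to any other element of D_r^*
   form a fundamental domain.  Projected radially to the hyperplane of real
   part 1, it is the set of all 1 + v with v in the solid prism
   |v_i| <= tan(pi/2r), v . (exp(k pi i / r) j) <= 1 (0 <= k < 2r), whose base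
   is a regular 2r-gon and whose axis is the line R i.  The two bases are
   matched by y with a twist of pi/r and opposite sides by the exp(k pi i/r) j
   with a twist of pi/2.  Rotating the prism by pi/r about its axis is
   q |-> a q a^-1 with a = exp(pi i / 2r). *)
Definition prism_axis : S3 R := expi (pi / (2 * r)%:R)%R.

Definition prism_rotation (x : prism_space) : prism_space :=
  \pi_prism_space (prism_axis * repr x * prism_axis^-1).

Lemma prism_axis_sqr : prism_axis * prism_axis = dstar_y.
Proof.
have -> : dstar_y = expi (pi / (2 * r)%:R + pi / (2 * r)%:R)%R.
  by congr expi; rewrite -mulrDl natrM; lra.
by apply: val_inj => /=; rewrite cosD sinD; congr (_, _, _, _); ring.
Qed.

Lemma prism_axis_normalizes (g : S3 R) :
  generated dstar_gens g ->
  generated dstar_gens (prism_axis * g * prism_axis^-1).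
Proof.
have xV : dstar_x * prism_axis^-1 = prism_axis * dstar_x.
  by apply: val_inj => /=; congr (_, _, _, _); ring.
have yV : prism_axis * dstar_y = dstar_y * prism_axis.
  by rewrite -prism_axis_sqr mulgA.
elim=> {g} [g [|] ->||g h _ gD _ hD|g _ gD].
- rewrite -mulgA xV mulgA prism_axis_sqr.
  by apply: generated_M; apply: generated_in; [right|left].
- by rewrite yV mulgK; apply: generated_in; right.
- by rewrite mulg1 mulgV; exact: generated_1.
- have -> : prism_axis * (g * h) * prism_axis^-1 =
      prism_axis * g * prism_axis^-1 * (prism_axis * h * prism_axis^-1).
    by rewrite !mulgA mulgKV.
  exact: generated_M.
- have -> : prism_axis * g^-1 * prism_axis^-1 =
      (prism_axis * g * prism_axis^-1)^-1 by rewrite !invgM invgK mulgA.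
  exact: generated_V.
Qed.

Lemma prism_rotationE (q : S3 R) :
  prism_rotation (\pi_prism_space q) =
  \pi_prism_space (prism_axis * q * prism_axis^-1).
Proof.
apply/esym/prism_space_eqP.
have /esym/prism_space_eqP[g gD ->] := reprK (\pi_prism_space q).
exists (prism_axis * g * prism_axis^-1); first exact: prism_axis_normalizes.
by rewrite !mulgA mulgKV.
Qed.

End PrismSpace.

(* Main.v *)
(* Write a quaternion as z + w j.  Left multiplication by D_r^* is generated by
   (z, w) |-> (e^(i pi/r) z, e^(i pi/r) w) and (z, w) |-> (- conj w, conj z), and
   the rotation of the prism is (z, w) |-> (z, e^(i pi/r) w).  So the prism space
   is the solid torus |z| >= |w| modulo the first map, with boundary points
   identified by the second.  Let a = arg z and b = arg w in units of pi/(6 r),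
   let s in [0, 2] measure |w|, and put t = s b.  The translations
   of a and b by 6 then act linearly on (a, s, t), and the cell 0 <= a <= 6,
   0 <= t <= 6 s, s <= 2 is cut into 36 straight tetrahedra, compatibly with these
   translations and, on s = 2, with the reflection (a, b) |-> (6 - b, 6 - a)
   coming from j.  The translates of the cell by Z_2r cover the prism space, which
   gives 72 r tetrahedra.

   The 36 tetrahedra are the domains of linearity of the lower convex hull of a
   height function on the 25 vertices of the cell: a point lies in the tetrahedron
   whose interpolation of the heights is largest at that point, and its
   barycentric coordinates are unique.  The vertices of the quotient are labelled
   by residues modulo 2 r of the form N + e r with N small, so that for all r >= 2
   at once a finite check shows that labels determine faces up to the group
   generated by the translations and j.  The resulting bijection is continuous
   with compact source, and the orbits of faces have length 1 (on the circle
   w = 0), r or 2 r. *)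
Require Import Defs.
From Stdlib Require Import ZArith.
From HB Require Import structures.
From mathcomp Require Import all_boot all_order all_algebra all_fingroup.
From mathcomp Require Import generic_quotient.
From mathcomp Require Import all_classical all_reals all_analysis.
From mathcomp Require Import ssrZ zify ring lra.
Import Order.TTheory GRing.Theory Num.Theory.
Import numFieldNormedType.Exports.

Set Implicit Arguments.
Unset Strict Implicit.
Unset Printing Implicit Defensive.

Local Open Scope ring_scope.
Delimit Scope Z_scope with zz.
Local Arguments Z.mul : simpl never.
Local Arguments Z.add : simpl never.
Local Arguments Z.sub : simpl never.

(** * The cell and its triangulation *)

Definition zr (R : pzRingType) (n : Z) : R := (int_of_Z n)%:~R.

Lemma zrD (R : pzRingType) m n : zr R (m + n)%zz = zr R m + zr R n.
Proof. by rewrite /zr -intrD -raddfD. Qed.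

Lemma zrM (R : pzRingType) m n : zr R (m * n)%zz = zr R m * zr R n.
Proof. by rewrite /zr -intrM -rmorphM. Qed.

Lemma zrN (R : pzRingType) m : zr R (- m)%zz = - zr R m.
Proof. by rewrite /zr -mulrNz -raddfN. Qed.

Lemma zrB (R : pzRingType) m n : zr R (m - n)%zz = zr R m - zr R n.
Proof. by rewrite -zrN -zrD. Qed.

Lemma zr0 (R : pzRingType) : zr R 0%zz = 0. Proof. by []. Qed.
Lemma zr1 (R : pzRingType) : zr R 1%zz = 1. Proof. by []. Qed.

Lemma zr_le (R : numDomainType) m n : (m <=? n)%zz -> zr R m <= zr R n.
Proof. by rewrite /zr ler_int; lia. Qed.

Lemma zr_lt (R : numDomainType) m n : (m <? n)%zz -> zr R m < zr R n.
Proof. by rewrite /zr ltr_int; lia. Qed.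

Lemma zr_nat (R : pzRingType) (n : nat) : zr R (Z.of_nat n) = n%:R.
Proof. by rewrite /zr pmulrn; congr (_ %:~R); lia. Qed.

(* coordinates (a, s, t) of the vertices of the cell *)
Definition pos_data : seq (Z * Z * Z) := [::
  (0, 0, 0); (6, 0, 0); (2, 0, 0); (4, 0, 0);
  (0, 1, 0); (0, 1, 6); (6, 1, 0); (6, 1, 6);
  (2, 1, 0); (2, 1, 6); (4, 1, 0); (4, 1, 6);
  (0, 2, 0); (0, 2, 12); (6, 2, 0); (6, 2, 12);
  (2, 2, 0); (2, 2, 12); (0, 2, 8); (6, 2, 8);
  (4, 2, 0); (4, 2, 12); (0, 2, 4); (6, 2, 4); (3, 2, 6)]%zz.

(** The heights enter only through [convex_check] and [cover_check]; any integers passing both would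
    serve. *)
Definition height_data : seq Z := [:: 2; 4; 0; -1;
  1; -1; 0; 1; -3; -4; -3; -3;
  5; 3; 2; 5; 0; -1; 0; 1; -2; -2; -1; -1; -4]%zz.

(* In the translate of the cell by k, a vertex with data (T, N, e) gets the label
   (T, c (N + e r + k)), where c = coef T is 0 on the circle w = 0 (types 0 to 2),
   2 if j identifies the vertex with one of its own translates (types 8 and 9),
   and 1 otherwise. *)
Definition sym_data : seq (nat * Z * bool) := [::
  (0, 0%zz, false); (0, 0%zz, false); (1, 0%zz, false); (2, 0%zz, false);
  (3, 0%zz, false); (3, 1%zz, false); (3, (-1)%zz, false); (3, 0%zz, false);
  (4, 0%zz, false); (4, 1%zz, false); (5, 0%zz, false); (5, 1%zz, false);
  (8, 0%zz, false); (8, 1%zz, false); (8, (-1)%zz, false); (8, 0%zz, false);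
  (6, 0%zz, false); (6, 1%zz, false); (6, 1%zz, true); (6, 0%zz, true);
  (7, 0%zz, false); (7, 1%zz, false); (7, 1%zz, true); (7, 0%zz, true);
  (9, 0%zz, false)]%N.

Definition tets : seq (seq nat) := [::
  [:: 0; 2; 8; 9]; [:: 0; 4; 5; 8]; [:: 0; 5; 8; 9]; [:: 1; 3; 6; 7];
  [:: 2; 3; 8; 9]; [:: 3; 6; 7; 11]; [:: 3; 6; 10; 11]; [:: 3; 8; 9; 10];
  [:: 3; 9; 10; 11]; [:: 4; 5; 8; 22]; [:: 4; 8; 16; 22]; [:: 4; 12; 16; 22];
  [:: 5; 8; 9; 22]; [:: 5; 9; 17; 18]; [:: 5; 9; 18; 22]; [:: 5; 13; 17; 18];
  [:: 6; 7; 11; 23]; [:: 6; 10; 11; 23]; [:: 6; 10; 20; 23];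
  [:: 6; 14; 20; 23]; [:: 7; 11; 21; 23]; [:: 7; 15; 19; 21];
  [:: 7; 19; 21; 23]; [:: 8; 9; 10; 24]; [:: 8; 9; 22; 24]; [:: 8; 10; 20; 24];
  [:: 8; 16; 20; 22]; [:: 8; 20; 22; 24]; [:: 9; 10; 11; 24];
  [:: 9; 11; 21; 24]; [:: 9; 17; 18; 24]; [:: 9; 17; 21; 24];
  [:: 9; 18; 22; 24]; [:: 10; 11; 23; 24]; [:: 10; 20; 23; 24];
  [:: 11; 21; 23; 24]]%N.

Definition vpos (i : nat) : Z * Z * Z := nth (0, 0, 0)%zz pos_data i.
Definition vheight (i : nat) : Z := nth 0%zz height_data i.
Definition vsym (i : nat) : nat * Z * bool := nth (0%N, 0%zz, false) sym_data i.

(* (c, u, v, w) is the affine function c + u a + v s + w t *)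
Definition affine : Type := (Z * Z * Z * Z)%type.

Definition evz (f : affine) (x : Z * Z * Z) : Z :=
  let: (c, u, v, w) := f in let: (a, s, t) := x in
  (c + u * a + v * s + w * t)%zz.

Definition addf (f g : affine) : affine :=
  let: (c, u, v, w) := f in let: (c', u', v', w') := g in
  (c + c', u + u', v + v', w + w')%zz.

Definition scalef (n : Z) (f : affine) : affine :=
  let: (c, u, v, w) := f in (n * c, n * u, n * v, n * w)%zz.

(** The linear part is the cross product of [q - p] and [r - p], which keeps all data integral. *)
Definition plane (p q r : Z * Z * Z) : affine :=
  let: (a, s, t) := p in let: (a1, s1, t1) := q in let: (a2, s2, t2) := r in
  let u := ((s1 - s) * (t2 - t) - (t1 - t) * (s2 - s))%zz in
  let v := ((t1 - t) * (a2 - a) - (a1 - a) * (t2 - t))%zz in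
  let w := ((a1 - a) * (s2 - s) - (s1 - s) * (a2 - a))%zz in
  (- (u * a + v * s + w * t), u, v, w)%zz.

(* The affine function vanishing on the facet of A opposite to i and positive
   at i. *)
Definition facet (A : seq nat) (i : nat) : affine :=
  let f := match [seq vpos j | j <- rem i A] with
           | [:: p; q; r] => plane p q r | _ => (0, 0, 0, 0)%zz end in
  scalef (Z.sgn (evz f (vpos i))) f.

(** For a tetrahedron this is six times the Euclidean volume, the common denominator of its
    barycentric coordinates. *)
Definition volume (A : seq nat) : Z :=
  evz (facet A (head 0%N A)) (vpos (head 0%N A)).

Definition sumf (A : seq nat) (c : nat -> Z) : affine :=
  foldr addf (0, 0, 0, 0)%zz [seq scalef (c i) (facet A i) | i <- A].

(* [volume A] times the affine interpolation of the heights on A *)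
Definition interpolation (A : seq nat) : affine := sumf A vheight.

Definition coord1 (x : Z * Z * Z) := x.1.1.
Definition coord2 (x : Z * Z * Z) := x.1.2.
Definition coord3 (x : Z * Z * Z) := x.2.

(** Certifies that the facet functions divided by the volume are barycentric coordinates: they
    reproduce the functions 1, a, s and t. *)
Definition bary_check := all (fun A =>
  let d := volume A in
  [&& (0 <? d)%zz, sumf A (fun=> 1%zz) == (d, 0, 0, 0)%zz,
      sumf A (coord1 \o vpos) == (0, d, 0, 0)%zz,
      sumf A (coord2 \o vpos) == (0, 0, d, 0)%zz,
      sumf A (coord3 \o vpos) == (0, 0, 0, d)%zz,
      uniq A &
      all (fun i => (i < 25)%N &&
        all (fun j => evz (facet A i) (vpos j) ==
                      (if i == j then d else 0%zz)) A) A]) tets.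

Definition convex_check := all (fun A => let d := volume A in let l :=
    interpolation A in
  all (fun i => if i \in A then evz l (vpos i) == (d * vheight i)%zz
                else (evz l (vpos i) <? d * vheight i)%zz) (iota 0 25)) tets.

(** The bound [0 <= s] is implied by the last two functions, [t] and [6 s - t]. *)
Definition walls : seq affine :=
  [:: (0, 1, 0, 0); (6, -1, 0, 0); (2, 0, -1, 0); (0, 0, 0, 1); (0, 0, 6,
      -1)]%zz.

(** Each facet function is a positive multiple of a wall, or else a positive multiple of the
    difference between the interpolations of A and of some B, each divided by its volume. Where A
    has the largest interpolation, all its facet functions are therefore nonnegative. *)
Definition cover_check := all (fun A => let d := volume A in let l :=
    interpolation A in
  all (fun i => let f := facet A i in
    has (fun g => let n := evz g (vpos i) in
      (0 <? n)%zz && (scalef d g == scalef n f)) walls ||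
    has (fun B => let c := (volume B * vheight i - evz (interpolation B) (vpos
        i))%zz in
      (0 <? c)%zz && (addf (scalef d (interpolation B)) (scalef c f) ==
                     scalef (volume B) l)) tets) A) tets.

Lemma bary_checkP : bary_check. Proof. by vm_compute. Qed.
Lemma convex_checkP : convex_check. Proof. by vm_compute. Qed.
Lemma cover_checkP : cover_check. Proof. by vm_compute. Qed.

(** * Barycentric coordinates in the cell *)

Section Cell.
Variable R : realFieldType.
Implicit Types (f g : affine) (x : R * R * R) (w : 'I_25 -> R) (A B : seq nat).

Definition ev f x : R :=
  let: (c, u, v, w) := f in let: (a, s, t) := x in
  zr R c + zr R u * a + zr R v * s + zr R w * t.

Definition zpt (p : Z * Z * Z) : R * R * R :=
  (zr R p.1.1, zr R p.1.2, zr R p.2).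

Lemma ev_addf f g x : ev (addf f g) x = ev f x + ev g x.
Proof.
case: f => [[[c u] v] w]; case: g => [[[c' u'] v'] w'].
by case: x => [[a s] t] /=; rewrite !zrD; ring.
Qed.

Lemma ev_scalef n f x : ev (scalef n f) x = zr R n * ev f x.
Proof.
by case: f => [[[c u] v] w]; case: x => [[a s] t] /=; rewrite !zrM; ring.
Qed.

Lemma ev_sumf A (c : nat -> Z) x :
  ev (sumf A c) x = \sum_(i <- A) zr R (c i) * ev (facet A i) x.
Proof.
rewrite /sumf.
have H l : ev (foldr addf (0, 0, 0, 0)%zz [seq scalef (c i) (facet A i) | i <-
    l]) x =
    \sum_(i <- l) zr R (c i) * ev (facet A i) x.
  elim: l => [|i l IHl] /=.
    by rewrite big_nil; case: x => [[a s] t] /=; rewrite zr0; ring.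
  by rewrite big_cons ev_addf ev_scalef IHl.
exact: H.
Qed.

(** The weights are functions on all 25 vertices, so that weights on different tetrahedra can be
    compared. *)
Definition weights A w : Prop :=
  [/\ forall i, 0 <= w i, \sum_i w i = 1 & forall i : 'I_25, w i != 0 -> (i :
      nat) \in A].

Definition bary w : R * R * R :=
  (\sum_i w i * zr R (vpos i).1.1, \sum_i w i * zr R (vpos i).1.2,
   \sum_i w i * zr R (vpos i).2).

Lemma ev_bary f w : \sum_i w i = 1 ->
  ev f (bary w) = \sum_i w i * zr R (evz f (vpos i)).
Proof.
move=> w1; rewrite /bary; case: f => [[[c u] v] z] /=.
rewrite -[zr R c]mulr1 -w1 !mulr_sumr -!big_split; apply: eq_bigr => i _ /=.
by case: (vpos i) => [[a s] t] /=; rewrite !zrD !zrM; ring.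
Qed.

Lemma sum_mem_seq A (F : nat -> R) : uniq A -> all (fun i => (i < 25)%N) A ->
  \sum_(i < 25) (if (i : nat) \in A then F i else 0) = \sum_(i <- A) F i.
Proof.
move=> uA A25; rewrite -(big_mkord xpredT (fun i => if i \in A then F i else
    0)).
rewrite -big_mkcond -big_filter; apply: perm_big; apply: uniq_perm => //.
  by rewrite filter_uniq// iota_uniq.
move=> i; rewrite mem_filter mem_index_iota /=.
by case: (boolP (i \in A)) => //= iA; rewrite (allP A25).
Qed.

Lemma tet_facts A : A \in tets ->
  [/\ 0 < zr R (volume A), uniq A, all (fun i => (i < 25)%N) A,
      (forall i j, i \in A -> j \in A ->
        evz (facet A i) (vpos j) = if i == j then volume A else 0%zz) &
      forall x, x = (\sum_(i <- A) zr R (vpos i).1.1 * (ev (facet A i) x / zr R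
          (volume A)),
                     \sum_(i <- A) zr R (vpos i).1.2 * (ev (facet A i) x / zr R
                         (volume A)),
                     \sum_(i <- A) zr R (vpos i).2 * (ev (facet A i) x / zr R
                         (volume A)))
       /\ \sum_(i <- A) ev (facet A i) x / zr R (volume A) = 1].
Proof.
move=> /(allP bary_checkP) /and5P[d0 /eqP s1 /eqP sa /eqP ss /and3P[/eqP st uA
    /allP fA]].
have dR : 0 < zr R (volume A) by exact: (@zr_lt R 0%zz).
split=> //.
- by apply/allP => i /fA /andP[].
- by move=> i j /fA/andP[_ /allP fj] /fj/eqP.
move=> x; have dn := lt0r_neq0 dR.
have H c : \sum_(i <- A) zr R (c i) * (ev (facet A i) x / zr R (volume A)) =
    ev (sumf A c) x / zr R (volume A).
  by rewrite ev_sumf mulr_suml; apply: eq_bigr => i _; rewrite mulrA.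
have H1 : \sum_(i <- A) ev (facet A i) x / zr R (volume A) =
    ev (sumf A (fun=> 1%zz)) x / zr R (volume A).
  by rewrite -H; apply: eq_bigr => i _; rewrite zr1 mul1r.
rewrite H1 s1 (H (coord1 \o vpos)) (H (coord2 \o vpos)) (H (coord3 \o vpos)) sa
    ss st.
case: x {H H1} => [[a s] t] /=; rewrite !zr0 !mul0r !addr0 !add0r.
by split; [congr (_, _, _); field | field].
Qed.

Definition in_cell x : Prop := forall g, g \in walls -> 0 <= ev g x.

(** Take the tetrahedron whose interpolation divided by its volume is largest at x. By [cover_check]
    its facet functions are nonnegative at x, and divided by the volume they are the weights. *)
Lemma cell_covered x : in_cell x ->
  exists A w, [/\ A \in tets, weights A w & bary w = x].
Proof.
move=> xc.
pose h (j : 'I_(size tets)) := let A := nth [::] tets j in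
  ev (interpolation A) x / zr R (volume A).
have [j _ jmax] := @arg_maxP _ _ _ (Ordinal (erefl : (0 < size tets)%N)) xpredT
    h isT.
pose A := nth [::] tets j.
have At : A \in tets by rewrite mem_nth.
have [dA uA A25 fA /(_ x) [xE s1]] := tet_facts At.
have hmax B : B \in tets -> ev (interpolation B) x / zr R (volume B) <= ev
    (interpolation A) x / zr R (volume A).
  move=> /(nthP [::])[k kB <-]; exact: (jmax (Ordinal kB)).
have f0 i : i \in A -> 0 <= ev (facet A i) x.
  move: cover_checkP => /allP/(_ _ At) /allP H /H {H} /orP[/hasP[g gw]|/hasP[B
      Bt]] /andP[n0 /eqP e].
    have := congr1 (ev^~ x) e; rewrite !ev_scalef => e'.
    have nR := @zr_lt R _ _ n0; rewrite zr0 in nR.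
    by rewrite -(pmulr_rge0 _ nR) -e' pmulr_rge0// xc.
  have := congr1 (ev^~ x) e; rewrite ev_addf !ev_scalef => e'.
  have nR := @zr_lt R _ _ n0; rewrite zr0 in nR.
  have [dB _ _ _ _] := tet_facts Bt.
  have := hmax _ Bt; rewrite ler_pdivrMr// mulrAC ler_pdivlMr// => le.
  rewrite -(pmulr_rge0 _ nR) -(lerD2l (zr R (volume A) * ev (interpolation B)
      x)) e' addr0.
  by rewrite mulrC (mulrC (zr R _)).
exists A, (fun i => if (i : nat) \in A then ev (facet A i) x / zr R (volume A)
    else 0).
split=> //.
  split.
  - by move=> i; case: ifP => // iA; rewrite divr_ge0 ?f0// ltW.
  - by rewrite (sum_mem_seq (fun i => ev (facet A i) x / zr R (volume A)))// s1.
  - by move=> i; case: ifP => //; rewrite eqxx.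
rewrite [RHS]xE /bary; congr (_, _, _); rewrite -sum_mem_seq//; apply: eq_bigr
    => i _;
  by case: ifP => _; rewrite ?mul0r// mulrC.
Qed.

(** The equality case, which singles out the vertices of A, is what makes weights unique in
    [bary_inj]. *)
Lemma interpolation_le A (i : 'I_25) : A \in tets ->
  zr R (evz (interpolation A) (vpos i)) <= zr R (volume A) * zr R (vheight i) ?=
    iff ((i : nat) \in A).
Proof.
move=> At; have := allP (allP convex_checkP _ At) i.
rewrite mem_iota ltn_ord => /(_ isT); case: ifP => _.
  by move=> /eqP->; rewrite zrM; exact: leif_refl.
by move=> /(@zr_lt R) lt; rewrite -zrM; apply/leifP.
Qed.

(** The facet function opposite to i vanishes at the other vertices of A, so only the term of i
    survives. *)
Lemma bary_weight A w (i : 'I_25) : A \in tets -> weights A w -> (i : nat) \in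
    A ->
  ev (facet A i) (bary w) = zr R (volume A) * w i.
Proof.
move=> At [w0 w1 wA] iA; have [_ _ _ fA _] := tet_facts At.
rewrite ev_bary// (bigD1 i)//= fA// eqxx mulrC big1 ?addr0// => j ji.
have [->|/wA jA] := eqVneq (w j) 0; first by rewrite mul0r.
by rewrite fA// eq_sym (negbTE ji : (j : nat) == i = false) mulr0.
Qed.

(* The heights make the interpolation over each tetrahedron a support function
   of their convex hull, touching it exactly over that tetrahedron. *)
Lemma bary_inj A B w w' : A \in tets -> B \in tets -> weights A w -> weights B
    w' ->
  bary w = bary w' -> w =1 w'.
Proof.
pose H (u : 'I_25 -> R) := \sum_i u i * zr R (vheight i).
(* Among weights with a given barycenter, those on a tetrahedron have the least mean height;
   equality confines the other support to that tetrahedron. *)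
have le C u v D : C \in tets -> weights C u -> weights D v -> bary u = bary v ->
    H u <= H v ?= iff [forall i, (v i != 0) ==> ((i : nat) \in C)].
  move=> Ct [u0 u1 uC] [v0 v1 vD] e.
  have [dC _ _ _ _] := tet_facts Ct.
  have Eu : ev (interpolation C) (bary u) = zr R (volume C) * H u.
    rewrite ev_bary// mulr_sumr; apply: eq_bigr => i _.
    have [->|/uC iC] := eqVneq (u i) 0; first by rewrite !mul0r mulr0.
    by have /leifP := interpolation_le i Ct; rewrite iC => /eqP->; rewrite
        mulrCA.
  have Hv : zr R (volume C) * H u <= zr R (volume C) * H v ?= iff
      [forall i, (v i != 0) ==> ((i : nat) \in C)].
    rewrite -Eu e ev_bary// mulr_sumr; apply: leif_sum => i _.
    rewrite mulrCA; have [->|vi] /= := eqVneq (v i) 0.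
      by rewrite !mul0r; exact: leif_refl.
    have vp : 0 < v i by rewrite lt_def vi v0.
    have := interpolation_le i Ct; rewrite -(mono_leif (ler_pM2l vp)).
    by [].
  by rewrite -(mono_leif (ler_pM2l dC)).
move=> At Bt wA wB e.
(* Each mean height bounds the other. The equality case puts the support of [w'] inside A, where the
   facet functions determine the weights. *)
have /eqP E : H w == H w' by rewrite eq_le (le _ _ _ _ At wA wB e) (le _ _ _ _
    Bt wB wA (esym e)).
have := (le _ _ _ _ At wA wB e).2; rewrite E eqxx => /esym/forallP supp.
have [dA _ _ _ _] := tet_facts At.
have w'A : weights A w'.
  by case: wB => ? ? ?; split=> // i /(implyP (supp i)).
move=> i; have [iA|iA] := boolP ((i : nat) \in A).
  apply: (mulfI (lt0r_neq0 dA)).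
  by rewrite -(bary_weight At wA iA) -(bary_weight At w'A iA) e.
case: wA w'A => _ _ wA [_ _ w'A].
have [->|/wA] := eqVneq (w i) 0; last by rewrite (negbTE iA).
by have [->//|/w'A] := eqVneq (w' i) 0; rewrite (negbTE iA).
Qed.
End Cell.

(** * Labels *)

Definition vtype (i : nat) : nat := (vsym i).1.1.
Definition vshift (i : nat) : Z := (vsym i).1.2.
Definition vflip (i : nat) : bool := (vsym i).2.
Definition coef (t : nat) : nat := nth 0%N [:: 0; 0; 0; 1; 1; 1; 1; 1; 2; 2]%N
    t.

(** A test, independent of r, for equality of labels after a translation by [M + f r]. With
    coefficient 2 the multiples of r drop out modulo 2 r. *)
Definition same_label (i j : nat) (M : Z) (f : bool) : bool :=
  (vtype i == vtype j) &&
  match coef (vtype i) with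
  | 0 => true
  | 1 => (vshift i =? vshift j + M)%zz && (vflip i == vflip j (+) f)
  | _ => (vshift i =? vshift j + M)%zz
  end.

(* The bounds on D ensure that the labels differ for every r >= 2. *)
Definition diff_label (i j : nat) (M : Z) (f : bool) : bool :=
  (vtype i != vtype j) ||
  let D := Z.abs (vshift i - vshift j - M) in
  match coef (vtype i) with
  | 0 => false
  | 1 => if vflip i (+) vflip j (+) f then (D <=? 1)%zz
         else (1 <=? D)%zz && (D <=? 3)%zz
  | _ => (D =? 1)%zz
  end.

(** The candidate translations matching the label of i with that of j. Halving modulo 2 r is
    ambiguous by r, hence two candidates for coefficient 2; coefficient 0 constrains nothing and is
    treated apart. *)
Definition shifts (i j : nat) : seq (Z * bool) :=
  let M := (vshift i - vshift j)%zz in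
  match coef (vtype i) with
  | 0 => [::]
  | 1 => [:: (M, vflip i (+) vflip j)]
  | _ => [:: (M, false); (M, true)]
  end.

Lemma coef_le2 t : (coef t <= 2)%N.
Proof. by do 11 (destruct t as [|t]; first by []); rewrite /coef nth_default.
    Qed.

Lemma not_multiple z q N : (0 < Z.abs z < N)%zz -> z <> (q * N)%zz.
Proof.
move=> zN e; have : (q = 0 \/ 1 <= q \/ q <= -1)%zz by lia.
by move=> [?|[q1|q1]]; subst z; nia.
Qed.

Section Labels.
Variable r : nat.
Hypothesis r2 : (2 <= r)%N.
Let n := (2 * r)%N.

Lemma n_gt1 : (1 < n)%N. Proof. rewrite /n; lia. Qed.

Lemma zrZn_eq0 z : zr 'Z_n z = 0 -> exists q, z = (q * Z.of_nat n)%zz.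
Proof.
have natP (m : nat) : m%:R = 0 :> 'Z_n -> (n %| m)%N.
  by move=> /(congr1 val); rewrite /= val_Zp_nat ?n_gt1// => /eqP.
have zP (m : nat) : zr 'Z_n (Z.of_nat m) = 0 -> exists q, Z.of_nat m = (q *
    Z.of_nat n)%zz.
  by rewrite zr_nat => /natP/dvdnP[q ->]; exists (Z.of_nat q); lia.
move=> z0; have [zp|zn] : (0 <= z)%zz \/ (z <= 0)%zz by lia.
  have e : z = Z.of_nat (Z.to_nat z) by lia.
  by rewrite e in z0 *; exact: zP.
have e : (- z)%zz = Z.of_nat (Z.to_nat (- z)) by lia.
have [q qE] : exists q, (- z)%zz = (q * Z.of_nat n)%zz.
  by rewrite e; apply: zP; rewrite -e zrN z0 oppr0.
by exists (- q)%zz; lia.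
Qed.

Lemma Zn_r2 : r%:R *+ 2 = 0 :> 'Z_n.
Proof. by rewrite -mulr_natl -natrM pchar_Zp ?n_gt1. Qed.

Lemma Zn_double (y : 'Z_n) : y *+ 2 = 0 -> y = 0 \/ y = r%:R.
Proof.
move=> y0; have yl : (y < n)%N by rewrite -[X in (_ < X)%N](Zp_cast n_gt1).
have : zr 'Z_n (Z.of_nat (y * 2)) = 0.
  by rewrite zr_nat natrM mulr_natr natr_Zp.
move=> /zrZn_eq0[q qE].
have : (y : nat) = 0%N \/ (y : nat) = r.
  by have : (q = 0 \/ q = 1)%zz; [nia|move=> [] ?; subst q; [left|right]; lia].
by move=> [] e; [left|right]; rewrite -(natr_Zp y) e.
Qed.

(** Only multiples of the coefficient occur as residues. Three types have coefficient 0, five have 1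
    and two have 2, which leaves 3 + 10 r + 2 r vertices. *)
Definition vertex_ok (v : 'I_10 * 'Z_n) : bool := [exists y, v.2 == y *+ coef
    v.1].
Definition vertex : finType := {v : 'I_10 * 'Z_n | vertex_ok v}.

Lemma vertex_okM (t : 'I_10) (y : 'Z_n) : vertex_ok (t, y *+ coef t).
Proof. by apply/existsP; exists y. Qed.

Definition mkvertex (t : 'I_10) (y : 'Z_n) : vertex :=
  exist vertex_ok (t, y *+ coef t) (vertex_okM t y).

Definition label_shift (M : Z) (f : bool) : 'Z_n := zr 'Z_n M + f%:R * r%:R.

Definition label (i : nat) (k : 'Z_n) : vertex :=
  mkvertex (inord (vtype i)) (label_shift (vshift i) (vflip i) + k).

Lemma vtype_lt i : (vtype i < 10)%N.
Proof.
have [i25|] := ltnP i 25; last by move=> i25; rewrite /vtype /vsym nth_default.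
by do 25 (destruct i as [|i]; first by []).
Qed.

Lemma label_eq i j k k' : (label i k == label j k') =
  (vtype i == vtype j) &&
  ((label_shift (vshift i) (vflip i) + k - (label_shift (vshift j) (vflip j) +
      k')) *+ coef (vtype i) == 0).
Proof.
rewrite -val_eqE /= xpair_eqE -val_eqE /= !inordK ?vtype_lt//.
by case: eqP => //= <-; rewrite mulrnBl subr_eq0.
Qed.

(** Twice r is zero modulo 2 r, so Boolean multiples of r add by exclusive or. *)
Lemma flip_r (b c : bool) : b%:R * r%:R + c%:R * r%:R = (b (+) c)%:R * r%:R :>
    'Z_n.
Proof. by case: b; case: c; rewrite /= ?mul0r ?mul1r ?addr0 ?add0r// -mulr2n
    Zn_r2. Qed.

Lemma r_opp : - r%:R = r%:R :> 'Z_n.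
Proof. by apply/eqP; rewrite eq_sym -subr_eq0 opprK -mulr2n Zn_r2. Qed.

Lemma shift_diff i j M f k :
  label_shift (vshift i) (vflip i) + k - (label_shift (vshift j) (vflip j) + (k
      + label_shift M f)) =
  label_shift (vshift i - vshift j - M) (vflip i (+) vflip j (+) f).
Proof.
rewrite /label_shift -!flip_r !zrB.
have opp (b : bool) : - (b%:R * r%:R) = b%:R * r%:R :> 'Z_n.
  by case: b; rewrite ?mul1r ?r_opp// mul0r oppr0.
rewrite -[X in _ = _ + (_ + X + _)]opp -[X in _ = _ + (_ + X)]opp; ring.
Qed.

Lemma same_labelP i j M f k :
  same_label i j M f -> label i k = label j (k + label_shift M f).
Proof.
move=> /andP[e h]; apply/eqP; rewrite label_eq e /= shift_diff /label_shift.
case: (coef _) h (coef_le2 (vtype i)) => [|[|m]] /= h c2; rewrite ?mulr0n//.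
  move: h => /andP[/Z.eqb_spec -> /eqP ->]; rewrite mulr1n.
  have -> : (vshift j + M - vshift j - M = 0)%zz by lia.
  by rewrite addbAC addbK addbb zr0 mul0r addr0.
move: h c2.
case: m => // /Z.eqb_spec -> _.
have -> : (vshift j + M - vshift j - M = 0)%zz by lia.
rewrite zr0 add0r; case: (_ (+) _); last by rewrite mul0r mul0rn.
by rewrite mul1r Zn_r2.
Qed.

Lemma shift_Z (D : Z) (b : bool) :
  label_shift D b = zr 'Z_n (D + (if b then Z.of_nat r else 0))%zz.
Proof. by rewrite zrD; case: b; rewrite /label_shift ?zr_nat ?mul1r// mul0r
    zr0. Qed.

(** The residues differ by an integer strictly between 0 and 2 r in absolute value; for coefficient
    2 this must hold for the difference and for its translate by r. The case [r = 2] is the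
    tightest: 3 < 2 r, 0 < r - 1 and r + 1 < 2 r. *)
Lemma diff_labelP i j M f k :
  diff_label i j M f -> label i k != label j (k + label_shift M f).
Proof.
rewrite label_eq /diff_label; case: eqP => //= e.
rewrite shift_diff; set D := (_ - _ - _)%zz; set E := _ (+) _.
move: D E (coef_le2 (vtype i)) => D E.
case: (coef _) => [|[|[|m]]] //= _ h.
  rewrite mulr1n; apply/eqP; rewrite shift_Z => /zrZn_eq0[q].
  by apply: not_multiple; rewrite /n; case: E h => h; lia.
apply/eqP => /Zn_double; rewrite shift_Z => -[|/eqP].
  by move=> /zrZn_eq0[q]; apply: not_multiple; rewrite /n; case: E; lia.
rewrite -subr_eq0 -zr_nat -zrB => /eqP/zrZn_eq0[q].
by apply: not_multiple; rewrite /n; case: E; lia.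
Qed.

(** Coefficient 1 determines the translation, and coefficient 2 determines it up to r by
    [Zn_double]. So [shifts] is exhaustive off the circle w = 0. *)
Lemma shiftsP i j k k' : (0 < coef (vtype i))%N -> label i k = label j k' ->
  vtype i = vtype j /\
  exists2 Mf, Mf \in shifts i j & k' = k + label_shift Mf.1 Mf.2.
Proof.
move=> c0 /eqP; rewrite label_eq => /andP[/eqP e h]; split=> //.
rewrite /shifts; set N := (_ - _)%zz.
have E : label_shift (vshift i) (vflip i) + k - (label_shift (vshift j) (vflip
    j) + k') =
    label_shift N (vflip i (+) vflip j) - (k' - k).
  have := @shift_diff i j 0%zz false k; rewrite addbF Z.sub_0_r => <-.
  by rewrite /label_shift zr0 mul0r; ring.
move: h c0; rewrite E; case: (coef _) (coef_le2 (vtype i)) => [|[|[|m]]]// _ h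
    _.
  exists (N, vflip i (+) vflip j); rewrite ?mem_head//=.
  by move/eqP: h; rewrite mulr1n => /subr0_eq ->; ring.
have [b ->] : exists b : bool, k' = k + label_shift N b; last first.
  by exists (N, b) => //; rewrite !inE; case: b; rewrite eqxx ?orbT.
move/eqP: h => /Zn_double; set x := label_shift N _ => h.
have [b bE] : exists b : bool, k' - k = label_shift N b.
  case: h => [/subr0_eq <-|]; first by exists (vflip i (+) vflip j).
  move=> h; exists (~~ (vflip i (+) vflip j)).
  have -> : k' - k = x - r%:R by rewrite -h; ring.
  rewrite r_opp /x /label_shift; case: (_ (+) _) => /=; rewrite ?mul0r ?mul1r
      ?addr0//.
  by rewrite -addrA -mulr2n Zn_r2 addr0.
by exists b; rewrite -bE; ring.
Qed.

End Labels.

(** * Gluing the cells *)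

(* [moved false p q] is the translation by (p, q) of (a, t / s); on s = 2,
   [moved true p q] is (a, b) |-> (1 - b + p, 1 - a + q), again with b = t / s
   and in units of 6. *)
Definition movedz (f : bool) (p q : Z) (x y : Z * Z * Z) : bool :=
  let: (a, s, t) := x in let: (a', s', t') := y in
  if f then [&& (s =? 2)%zz, (s' =? 2)%zz, (2 * a' =? 12 - t + 12 * p)%zz
              & (t' =? 12 - 2 * a + 12 * q)%zz]
  else [&& (a' =? a + 6 * p)%zz, (s' =? s)%zz & (t' =? t + 6 * q * s)%zz].

(** A single B must receive all vertices of A on the wall, so that convex combinations of them stay
    in one tetrahedron. The shift is [p - q] because only a simultaneous translation of both angles
    comes from a power of y. *)
Definition move_check (wall : Z * Z * Z -> bool) (f : bool) (p q : Z) :=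
  all (fun A => has (fun B => all (fun i => wall (vpos i) ==>
    has (fun j => movedz f p q (vpos i) (vpos j) && same_label i j (p - q) f)
        B) A)
    tets) tets.

Lemma move_check_a : move_check (fun x => x.1.1 =? 6)%zz false (-1) 0.
Proof. by vm_compute. Qed.

Lemma move_check_t : move_check (fun x => x.2 =? 6 * x.1.2)%zz false 0 (-1).
Proof. by vm_compute. Qed.

Lemma move_check_s : move_check (fun x => x.1.2 =? 2)%zz true 0 0.
Proof. by vm_compute. Qed.

(** Integer division only proposes a move; [glue_check] then verifies it with [movedz]. *)
Definition find_move (f : bool) (i j : nat) : Z * Z :=
  let: (a, s, t) := vpos i in let: (a', s', t') := vpos j in
  if f then ((2 * a' - 12 + t) / 12, (t' - 12 + 2 * a) / 12)%zz
  else ((a' - a) / 6, (t' - t) / (6 * s))%zz.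

(* Two vertices with a common label determine how one tetrahedron has to be
   moved to match the other, and all other common labels then match too. *)
Definition glue_check := all (fun A => all (fun B =>
  all (fun i => all (fun j => (vtype i == vtype j) ==>
    if coef (vtype i) == 0%N then
      all (fun i' => all (fun j' =>
        (vtype i' == vtype j') && (coef (vtype i') == 0%N) ==>
        movedz false (find_move false i j).1 0 (vpos i') (vpos j')) B) A
    else all (fun Mf => let: (p, q) := find_move Mf.2 i j in
      (p - q =? Mf.1)%zz &&
      all (fun i' => all (fun j' => diff_label i' j' Mf.1 Mf.2 ||
        movedz Mf.2 p q (vpos i') (vpos j')) B) A) (shifts i j)) B) A) tets)
            tets.

Lemma glue_checkP : glue_check. Proof. by vm_compute. Qed.

Definition core_check := all (fun i => (coef (vtype i) == 0%N) ==> (coord2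
    (vpos i) =? 0)%zz) (iota 0 25).
Lemma core_checkP : core_check. Proof. by vm_compute. Qed.

Definition inj_check := all (fun A => all (fun i => all (fun j =>
  (i == j) || diff_label i j 0 false) A) A) tets.
Lemma inj_checkP : inj_check. Proof. by vm_compute. Qed.

(** * Transport of weights by moves, and moves recovered from equal labels *)

Section Moves.
Variables (R : realFieldType) (r : nat).
Hypothesis r2 : (2 <= r)%N.
Local Notation Zn := 'Z_(2 * r).

Definition moved (f : bool) (p q : Z) (x y : R * R * R) : Prop :=
  let: (a, s, t) := x in let: (a', s', t') := y in
  if f then [/\ s = 2, s' = 2, 2 * a' = 12 - t + 12 * zr R p
              & t' = 12 - 2 * a + 12 * zr R q]
  else [/\ a' = a + 6 * zr R p, s' = s & t' = t + 6 * zr R q * s].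

Lemma moved_zpt f p q x y : movedz f p q x y -> moved f p q (zpt R x) (zpt R y).
Proof.
case: x => [[a s] t]; case: y => [[a' s'] t']; rewrite /movedz /moved /=.
have c k : zr R k = (int_of_Z k)%:~R by [].
have e2 : zr R 2%zz = 2 by [].
have e6 : zr R 6%zz = 6 by [].
have e12 : zr R 12%zz = 12 by [].
case: f => [/and4P[/Z.eqb_spec -> /Z.eqb_spec -> /Z.eqb_spec/(congr1 (zr R)) +
    /Z.eqb_spec ->]|].
  by rewrite !(zrD, zrM, zrB) e2 e12 => ->.
by move=> /and3P[/Z.eqb_spec -> /Z.eqb_spec -> /Z.eqb_spec ->]; rewrite !(zrD,
    zrM) e6.
Qed.

(** The barycentric coordinates in the quotient complex of the point with weights w in the translate
    by k. *)
Definition push (w : 'I_25 -> R) (k : Zn) (v : vertex r) : R :=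
  \sum_(i : 'I_25 | label i k == v) w i.

Lemma eq_mull (a x y : R) : (a != 0 -> x = y) -> a * x = a * y.
Proof. by have [->|_ /(_ isT) ->//] := eqVneq a 0; rewrite !mul0r. Qed.

Lemma pushE w k v : push w k v = \sum_(i : 'I_25) w i * (label i k == v)%:R.
Proof.
rewrite /push big_mkcond; apply: eq_bigr => i _.
by case: ifP; rewrite ?mulr1 ?mulr0.
Qed.

(** For fixed f, p and q the equations defining [moved] are affine in the pair (x, y), hence stable
    under affine combinations. *)
Lemma moved_sum f p q (I : finType) (w : I -> R) (x y : I -> R * R * R) :
  \sum_i w i = 1 -> (forall i, w i != 0 -> moved f p q (x i) (y i)) ->
  moved f p q
    (\sum_i w i * (x i).1.1, \sum_i w i * (x i).1.2, \sum_i w i * (x i).2)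
    (\sum_i w i * (y i).1.1, \sum_i w i * (y i).1.2, \sum_i w i * (y i).2).
Proof.
move=> w1 H.
have S c : c = \sum_i w i * c by rewrite -mulr_suml w1 mul1r.
have E (F G : I -> R) : (forall i, w i != 0 -> F i = G i) ->
    \sum_i w i * F i = \sum_i w i * G i.
  by move=> FG; apply: eq_bigr => i _; apply: eq_mull => /FG.
case: f H => H /=.
  have H' i : w i != 0 -> [/\ (x i).1.2 = 2, (y i).1.2 = 2,
      2 * (y i).1.1 = 12 - (x i).2 + 12 * zr R p
      & (y i).2 = 12 - 2 * (x i).1.1 + 12 * zr R q].
    by move/H; case: (x i) => [[a s] t]; case: (y i) => [[a' s'] t'].
  split.
  - by rewrite [RHS]S; apply: E => i /H' [].
  - by rewrite [RHS]S; apply: E => i /H' [].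
  - rewrite [X in X - _]S [X in _ + X]S -sumrB -big_split mulr_sumr /=.
    transitivity (\sum_i w i * (2 * (y i).1.1)).
      by apply: eq_bigr => i _; rewrite mulrCA.
    transitivity (\sum_i w i * (12 - (x i).2 + 12 * zr R p)).
      by apply: E => i /H' [].
    by apply: eq_bigr => i _; ring.
  - rewrite [X in X - _]S [X in _ + X]S mulr_sumr -sumrB -big_split /=.
    transitivity (\sum_i w i * (12 - 2 * (x i).1.1 + 12 * zr R q)).
      by apply: E => i /H' [].
    by apply: eq_bigr => i _; ring.
have H' i : w i != 0 -> [/\ (y i).1.1 = (x i).1.1 + 6 * zr R p,
    (y i).1.2 = (x i).1.2 & (y i).2 = (x i).2 + 6 * zr R q * (x i).1.2].
  by move/H; case: (x i) => [[a s] t]; case: (y i) => [[a' s'] t'].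
split.
- rewrite [X in _ + X]S -big_split /=.
  transitivity (\sum_i w i * ((x i).1.1 + 6 * zr R p)).
    by apply: E => i /H' [].
  by apply: eq_bigr => i _; ring.
- by apply: E => i /H' [].
- rewrite mulr_sumr -big_split /=.
  transitivity (\sum_i w i * ((x i).2 + 6 * zr R q * (x i).1.2)).
    by apply: E => i /H' [].
  by apply: eq_bigr => i _; ring.
Qed.

Lemma move_weights wall f p q A w (k : Zn) : move_check wall f p q ->
  A \in tets -> weights A w -> (forall i : 'I_25, w i != 0 -> wall (vpos i)) ->
  exists B w', [/\ B \in tets, weights B w', moved f p q (bary w) (bary w') &
    push w k =1 push w' (k + label_shift r (p - q) f)].
Proof.
move=> ch At [w0 w1 wA] ww.
have /hasP[B Bt /allP H] := allP ch A At.
have {}H (i : 'I_25) : exists j : 'I_25, w i != 0 ->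
    [/\ (j : nat) \in B, movedz f p q (vpos i) (vpos j) & same_label i j (p -
        q) f].
  have [_|wi] := eqVneq (w i) 0; first by exists i.
  have /hasP[j jB /andP[jm js]] := implyP (H _ (wA _ wi)) (ww _ wi).
  have [_ _ /allP B25 _ _] := tet_facts R Bt.
  by exists (Ordinal (B25 _ jB)).
have [m mP] := fin_all_exists H.
(* The image of the weights under the vertex matching [m]. *)
pose w' j := \sum_(i | m i == j) w i.
have sumE (F : 'I_25 -> R) : \sum_j w' j * F j = \sum_i w i * F (m i).
  rewrite [RHS](partition_big m xpredT)//=; apply: eq_bigr => j _.
  by rewrite mulr_suml; apply: eq_bigr => i /eqP ->.
have w'1 : \sum_j w' j = 1.
  by rewrite -w1 [RHS](partition_big m xpredT).
exists B, w'; split=> //.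
- split=> // [j|j]; first exact: sumr_ge0.
  have [i /andP[/eqP <- wi] _|h] := pickP [pred i | (m i == j) && (w i != 0)].
    by have [] := mP i wi.
  rewrite /w' big1 ?eqxx// => i mij.
  by have := h i; rewrite /= mij => /negbFE/eqP.
- by rewrite /bary !sumE; apply: (@moved_sum f p q _ w (fun i => zpt R (vpos
    i)) (fun i => zpt R (vpos (m i)))) => // i /mP[_ /moved_zpt].
move=> v; rewrite pushE; apply: etrans (esym (pushE w' _ v)).
apply: etrans (esym (sumE (fun j : 'I_25 => (label j (k + label_shift r (p - q)
    f) == v)%:R))).
apply: eq_bigr => i _; apply: eq_mull => /mP[_ _ /(same_labelP r2 k) e].
by rewrite e.
Qed.

Lemma push_ge0 A w k v : weights A w -> 0 <= push w k v.
Proof. by move=> [w0 _ _]; exact: sumr_ge0. Qed.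

Lemma push_neq0 A w k v : weights A w ->
  push w k v != 0 -> exists i : 'I_25, w i != 0 /\ label i k = v.
Proof.
move=> [w0 _ _]; have [i /andP[/eqP <- wi]|h] := pickP [pred i : 'I_25 | (label
    i k == v) && (w i != 0)].
  by exists i.
rewrite /push big1 ?eqxx// => i iv.
by have := h i; rewrite /= iv => /negbFE/eqP.
Qed.

Lemma push_label A w k (i : 'I_25) : weights A w -> w i != 0 ->
  push w k (label i k) != 0.
Proof.
move=> [w0 _ _] wi; rewrite /push (bigD1 i)//= gt_eqF//.
by rewrite ltr_pwDl ?sumr_ge0// lt_def wi w0.
Qed.

(** Group both sums by labels. Over a label of positive total weight both supports are met, so F and
    F' share one constant value there. *)
Lemma push_sum A B w w' k k' (F F' : 'I_25 -> R) : weights A w -> weights B w'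
    ->
  push w k =1 push w' k' ->
  (forall i j : 'I_25, w i != 0 -> w' j != 0 -> label i k = label j k' -> F i =
      F' j) ->
  \sum_i w i * F i = \sum_j w' j * F' j.
Proof.
move=> wA wB e FF'.
rewrite (partition_big (fun i : 'I_25 => label i k) xpredT)//=.
rewrite [RHS](partition_big (fun i : 'I_25 => label i k') xpredT)//=.
apply: eq_bigr => v _; have [p0|p0] := eqVneq (push w k v) 0.
  have z u l : (forall i, 0 <= u i) -> push u l v = 0 ->
      forall i : 'I_25, label i l == v -> u i = 0.
    move=> u0 pu i iv; apply/eqP.
    have /eqP := pu; rewrite /push psumr_eq0// => /allP/(_ i (mem_index_enum
        i)).
    by rewrite iv.
  rewrite !big1// => i iv.
    by rewrite (z w' k' _ _ i iv) ?mul0r -?e//; case: wB.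
  by rewrite (z w k _ _ i iv) ?mul0r//; case: wA.
have [i [wi iv]] := push_neq0 wA p0.
have [j [wj jv]] : exists j : 'I_25, w' j != 0 /\ label j k' = v.
  by apply: push_neq0 wB _; rewrite -e.
transitivity (push w k v * F i).
  rewrite /push mulr_suml; apply: eq_bigr => l /eqP lv.
  have [->|wl] := eqVneq (w l) 0; first by rewrite !mul0r.
  by rewrite (FF' l j) ?(FF' i j) ?lv ?iv.
rewrite e /push mulr_suml; apply: eq_bigr => l /eqP lv.
have [->|wl] := eqVneq (w' l) 0; first by rewrite !mul0r.
by rewrite (FF' i l) ?lv ?iv.
Qed.

Lemma core_label i : (i < 25)%N -> coef (vtype i) = 0%N -> coord2 (vpos i) =
    0%zz.
Proof.
move=> i25 c0; have := allP core_checkP i; rewrite mem_iota i25 => /(_ isT).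
by rewrite c0 => /Z.eqb_spec.
Qed.

(** One vertex of positive weight off the circle w = 0 fixes the move, and [glue_check] shows that
    it fits all common labels. If no such vertex exists, the point has s = 0 and the residues carry
    no information. *)
Lemma push_moved A B w w' k k' : A \in tets -> B \in tets ->
  weights A w -> weights B w' -> push w k =1 push w' k' ->
  exists f p q, moved f p q (bary w) (bary w') /\
    (k' = k + label_shift r (p - q) f \/ ~~ f /\ (bary w).1.2 = 0).
Proof.
move=> At Bt wA wB e.
(* A move relating all equally labelled vertices relates the barycenters, by [push_sum] applied to
   each affine equation. *)
have key f p q : (forall i j : 'I_25, w i != 0 -> w' j != 0 -> label i k =
    label j k' ->
    movedz f p q (vpos i) (vpos j)) -> moved f p q (bary w) (bary w').
  move=> H.
  have wA1 : \sum_i w i = 1 by case: wA.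
  have wB1 : \sum_i w' i = 1 by case: wB.
  have S c : \sum_i w i * c = c by rewrite -mulr_suml wA1 mul1r.
  have S' c : \sum_i w' i * c = c by rewrite -mulr_suml wB1 mul1r.
  have PS := push_sum wA wB e.
  case: f H => H; rewrite /moved /bary.
    have H' (i j : 'I_25) : w i != 0 -> w' j != 0 -> label i k = label j k' ->
        moved true p q (zpt R (vpos i)) (zpt R (vpos j)).
      by move=> wi wj ij; exact: moved_zpt (H _ _ wi wj ij).
    split.
    - rewrite -[RHS]S'; apply: PS => i j wi wj ij.
      by case: (H' _ _ wi wj ij).
    - rewrite -[RHS]S; apply/esym; apply: PS => i j wi wj ij.
      by case: (H' _ _ wi wj ij).
    - rewrite -[X in X - _]S -[X in _ + X]S -sumrB -big_split mulr_sumr /=.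
      transitivity (\sum_i w' i * (2 * zr R (vpos i).1.1)).
        by apply: eq_bigr => i _; rewrite mulrCA.
      transitivity (\sum_i w i * (12 - zr R (vpos i).2 + 12 * zr R p)).
        by apply/esym; apply: PS => i j wi wj ij; case: (H' _ _ wi wj ij).
      by apply: eq_bigr => i _; ring.
    - rewrite -[X in X - _]S -[X in _ + X]S mulr_sumr -sumrB -big_split /=.
      transitivity (\sum_i w i * (12 - 2 * zr R (vpos i).1.1 + 12 * zr R q)).
        by apply/esym; apply: PS => i j wi wj ij; case: (H' _ _ wi wj ij).
      by apply: eq_bigr => i _; ring.
  have H' (i j : 'I_25) : w i != 0 -> w' j != 0 -> label i k = label j k' ->
      moved false p q (zpt R (vpos i)) (zpt R (vpos j)).
    by move=> wi wj ij; exact: moved_zpt (H _ _ wi wj ij).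
  split.
  - rewrite -[X in _ + X]S -big_split /=.
    transitivity (\sum_i w i * (zr R (vpos i).1.1 + 6 * zr R p)).
      by apply/esym; apply: PS => i j wi wj ij; case: (H' _ _ wi wj ij).
    by apply: eq_bigr => i _; ring.
  - by apply/esym; apply: PS => i j wi wj ij; case: (H' _ _ wi wj ij).
  - rewrite mulr_sumr -big_split /=.
    transitivity (\sum_i w i * (zr R (vpos i).2 + 6 * zr R q * zr R (vpos
        i).1.2)).
      by apply/esym; apply: PS => i j wi wj ij; case: (H' _ _ wi wj ij).
    by apply: eq_bigr => i _; ring.
have [wA0 wA1 wAA] := wA; have [_ _ wBB] := wB.
have ex (i : 'I_25) : w i != 0 -> exists j : 'I_25, w' j != 0 /\ label i k =
    label j k'.
  move=> wi; have := push_label k wA wi; rewrite e => /(push_neq0 wB)[j [wj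
      <-]].
  by exists j.
have G (i j : 'I_25) : w i != 0 -> w' j != 0 -> vtype i = vtype j -> 
  if coef (vtype i) == 0%N then
      all (fun i' => all (fun j' =>
        (vtype i' == vtype j') && (coef (vtype i') == 0%N) ==>
        movedz false (find_move false i j).1 0 (vpos i') (vpos j')) B) A
    else all (fun Mf => let: (p, q) := find_move Mf.2 i j in
      (p - q =? Mf.1)%zz &&
      all (fun i' => all (fun j' => diff_label i' j' Mf.1 Mf.2 ||
        movedz Mf.2 p q (vpos i') (vpos j')) B) A) (shifts i j).
  move=> wi wj ij; have := allP (allP glue_checkP _ At) _ Bt.
  by move=> /allP/(_ _ (wAA _ wi))/allP/(_ _ (wBB _ wj)); rewrite ij eqxx.
have [i /andP[wi ci]|core] := pickP [pred i : 'I_25 | (w i != 0) && (0 < coef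
    (vtype i))%N].
  have [j [wj ij]] := ex _ wi.
  have [tij [Mf Mfs k'E]] := shiftsP r2 ci ij.
  have := G _ _ wi wj tij; rewrite -[_ == 0%N]leqn0 leqNgt ci /= => /allP/(_ _
      Mfs).
  case: (find_move _ _ _) => p q /andP[/Z.eqb_spec pq /allP H].
  exists Mf.2, p, q; split; last by left; rewrite pq.
  apply: key => i' j' wi' wj' ij'.
  have /orP[|//] := allP (H _ (wAA _ wi')) _ (wBB _ wj').
  by move=> /(diff_labelP r2 k); rewrite -k'E ij' eqxx.
have c0 i : w i != 0 -> coef (vtype i) = 0%N.
  by move=> wi; have := core i; rewrite /= wi /= lt0n => /negbFE/eqP.
have [i wi] : exists i, w i != 0.
  have [i wi|h] := pickP [pred i | w i != 0]; first by exists i.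
  have : \sum_i w i = 0 by apply: big1 => i _; have /negbFE/eqP := h i.
  by rewrite wA1 => /eqP; rewrite oner_eq0.
have [j [wj ij]] := ex _ wi.
have te i' j' : label i' k = label j' k' -> vtype i' = vtype j'.
  by move/eqP; rewrite label_eq => /andP[/eqP].
have := G _ _ wi wj (te _ _ ij); rewrite c0// eqxx => /allP H.
(* The angle of w is immaterial where s = 0, so [q = 0] can be chosen. *)
exists false, (find_move false i j).1, 0%zz; split.
  apply: key => i' j' wi' wj' ij'.
  have := allP (H _ (wAA _ wi')) _ (wBB _ wj').
  by rewrite (te _ _ ij') eqxx -(te _ _ ij') c0.
right; split=> //; rewrite /bary /= big1// => i' _.
have [->|wi'] := eqVneq (w i') 0; first by rewrite mul0r.
by have := core_label (ltn_ord i') (c0 _ wi'); rewrite /coord2 => ->; rewrite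
    zr0 mulr0.
Qed.

End Moves.

(** * Polar coordinates on the 3-sphere *)

Section Circle.
Variable R : realType.
Implicit Types x y : R.

Lemma zr_floor x : exists n : Z, zr R n <= x < zr R n + 1.
Proof.
exists (Z_of_int (Num.floor x)); rewrite /zr Z_of_intK.
by have := floor_itv x; rewrite intrD.
Qed.

Lemma cos_sin_period x (n : Z) :
  cos (x + zr R n * (pi *+ 2)) = cos x /\ sin (x + zr R n * (pi *+ 2)) = sin x.
Proof.
have nat_period (m : nat) y : cos (y + m%:R * (pi *+ 2)) = cos y /\
    sin (y + m%:R * (pi *+ 2)) = sin y.
  by rewrite mulr_natl periodicn ?(periodicn (@sinD2pi _))//; exact: cosD2pi.
have [nE|nE] : n = Z.of_nat (Z.to_nat n) \/ n = (- Z.of_nat (Z.to_nat (-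
    n)))%zz by lia.
  by rewrite nE zr_nat.
have [c s] := nat_period (Z.to_nat (- n)) (x + zr R n * (pi *+ 2)).
have e : zr R n = - (Z.to_nat (- n))%:R by rewrite {1}nE zrN zr_nat.
by rewrite -c -s e mulNr subrK.
Qed.

(** Reduce to [0 <= y < 2 pi]. Injectivity of [cos] on [0, pi] gives y = 0 in the lower half, and
    the reflection [2 pi - y] excludes the upper half. *)
Lemma cos_eq1 x : cos x = 1 -> exists n : Z, x = zr R n * (pi *+ 2).
Proof.
have pi2 : 0 < pi *+ 2 :> R by rewrite pmulrn_lgt0// pi_gt0.
have [n /andP[n1 n2]] := zr_floor (x / (pi *+ 2)); move: n1 n2.
rewrite ler_pdivlMr// ltr_pdivrMr// mulrDl mul1r => n1 n2 c1.
exists n; pose y := x - zr R n * (pi *+ 2).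
have yx : x = y + zr R n * (pi *+ 2) by rewrite subrK.
have y1 : cos y = cos 0 by rewrite cos0; have [] := cos_sin_period y n; rewrite
    -yx c1.
have y0 : 0 <= y by rewrite subr_ge0.
have yl : y < pi *+ 2 by rewrite /y ltrBlDl.
have pi0 := @pi_ge0 R.
have [ylp|ylp] := leP y pi.
  have y_eq0 : y = 0 by apply: cos_inj => //; rewrite in_itv /= ?lexx ?y0.
  by rewrite yx y_eq0 add0r.
have e : cos (pi *+ 2 - y) = cos 0.
  by rewrite -y1 -cosN opprB; have [<- _] := cos_sin_period (y - pi *+ 2) 1;
      rewrite zr1 mul1r subrK.
have : pi *+ 2 - y = 0.
  by apply: cos_inj e; rewrite in_itv /= ?lexx//; apply/andP; split; rewrite
      mulr2n; lra.
by move: yl; lra.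
Qed.

Lemma cos_sin_eq x y : cos x = cos y -> sin x = sin y ->
  exists n : Z, x = y + zr R n * (pi *+ 2).
Proof.
move=> c s; have [|n e] := @cos_eq1 (x - y).
  by rewrite cosB c s -!expr2 cos2Dsin2.
by exists n; rewrite -e addrC subrK.
Qed.

Lemma polar x y : exists t, x = Num.sqrt (x ^+ 2 + y ^+ 2) * cos t /\
  y = Num.sqrt (x ^+ 2 + y ^+ 2) * sin t.
Proof.
set p := Num.sqrt _; have p2 : p ^+ 2 = x ^+ 2 + y ^+ 2.
  by rewrite sqr_sqrtr// addr_ge0// sqr_ge0.
have p_ge0 : 0 <= p by exact: sqrtr_ge0.
have [p0|p0] := eqVneq p 0.
  exists 0; move: p2; rewrite p0 !mul0r expr0n /= => /esym/eqP.
  by rewrite paddr_eq0 ?sqr_ge0// !sqrf_eq0 => /andP[/eqP-> /eqP->].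
have pp : 0 < p by rewrite lt_def p0.
have b : -1 <= x / p <= 1.
  rewrite -ler_norml normrM normfV (ger0_norm p_ge0) ler_pdivrMr// mul1r.
  rewrite -[leRHS](ger0_norm p_ge0) -ler_sqr ?nnegrE// !real_normK ?num_real//.
  by rewrite p2 lerDl sqr_ge0.
have c : cos (acos (x / p)) = x / p by rewrite acosK// in_itv.
have s : sin (acos (x / p)) = `|y| / p.
  rewrite sin_acos// -[`|y| / p]ger0_norm ?divr_ge0// -sqrtr_sqr; congr
      Num.sqrt.
  by rewrite !expr_div_n real_normK ?num_real// p2; field; rewrite -p2
      expf_neq0.
have [y0|y0] := leP 0 y.
  exists (acos (x / p)); rewrite c s (ger0_norm y0).
  by split; field.
exists (- acos (x / p)); rewrite cosN sinN c s (ltr0_norm y0).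
by split; field.
Qed.

End Circle.

(** * Polar form of unit quaternions and the action of the group on it *)

Section Torus.
Variable R : realType.

(* cos T e^(iA) + sin T e^(iB) j *)
Definition qpolar (T A B : R) : quaternion R :=
  (cos T * cos A, cos T * sin A, sin T * cos B, sin T * sin B).

Lemma qpolar_norm T A B : qnorm2 (qpolar T A B) = 1.
Proof.
rewrite /= !exprMn -mulrDr -addrA -mulrDr !cos2Dsin2 !mulr1; exact: cos2Dsin2.
Qed.

Definition spolar T A B : S3 R := mkS3 (qpolar_norm T A B).

Lemma expi_mul x y : (expi x * expi y)%g = expi (x + y) :> S3 R.
Proof. by apply: val_inj => /=; rewrite cosD sinD; congr (_, _, _, _); ring.
    Qed.

Lemma expi_inv x : (expi x)^-1%g = expi (- x) :> S3 R.
Proof. by apply: val_inj => /=; rewrite cosN sinN oppr0. Qed.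

Lemma expi_polar x T A B : (expi x * spolar T A B)%g = spolar T (x + A) (x + B).
Proof. by apply: val_inj; rewrite /= /qpolar !cosD !sinD; congr (_, _, _, _);
    ring. Qed.

(** Left multiplication by j sends (z, w) to (- conj w, conj z) and so exchanges the solid tori
    [T <= pi / 4] and [T >= pi / 4]. *)
Lemma quat_j_polar T A B :
  (quat_j R * spolar T A B)%g = spolar (pi / 2 - T) (pi - B) (- A).
Proof.
apply: val_inj; rewrite /= /qpolar !cosB !sinB sinpi cospi sin_pihalf
    cos_pihalf cosN sinN.
by congr (_, _, _, _); ring.
Qed.

(** Conjugation by e^(ix) fixes z; since j e^(-ix) = e^(ix) j, it turns w by twice the angle. *)
Lemma conj_polar x T A B :
  (expi x * spolar T A B * (expi x)^-1)%g = spolar T A (B + 2 * x).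
Proof.
rewrite expi_polar expi_inv; apply: val_inj; rewrite /= /qpolar mulr_natl
    mulr2n.
have := cos2Dsin2 x; rewrite !(cosD, sinD, cosN, sinN) => cs.
congr (_, _, _, _); first 2 last.
- ring.
- ring.
- transitivity (cos T * cos A * (cos x ^+ 2 + sin x ^+ 2)); last by rewrite cs
    mulr1.
  ring.
- transitivity (cos T * sin A * (cos x ^+ 2 + sin x ^+ 2)); last by rewrite cs
    mulr1.
  ring.
Qed.

Lemma polar_exists (q : S3 R) : exists T A B, 0 <= T <= pi / 2 /\ q = spolar T
    A B.
Proof.
case: q => [[[[a b] c] d] h].
have n1 : a ^+ 2 + b ^+ 2 + c ^+ 2 + d ^+ 2 = 1 := set_mem h.
have [A [aE bE]] := polar a b; have [B [cE dE]] := polar c d.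
set p := Num.sqrt _ in aE bE; set q := Num.sqrt _ in cE dE.
have [T [pE qE]] := polar p q.
have pq : p ^+ 2 + q ^+ 2 = 1.
  by rewrite !sqr_sqrtr ?addr_ge0 ?sqr_ge0// addrA.
rewrite pq sqrtr1 !mul1r in pE qE.
have p0 : 0 <= p by exact: sqrtr_ge0.
have q0 : 0 <= q by exact: sqrtr_ge0.
have p1 : -1 <= p <= 1 by rewrite pE cos_geN1 cos_le1.
have cT : cos (acos p) = p by rewrite acosK// in_itv.
have sT : sin (acos p) = q.
  rewrite sin_acos// -[q]ger0_norm// -sqrtr_sqr -pq; congr Num.sqrt; ring.
exists (acos p), A, B; split; last first.
  by apply: val_inj; rewrite /= /qpolar cT sT -aE -bE -cE -dE.
(* Beyond [pi / 2] the cosine p would be negative. *)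
rewrite acos_ge0//= leNgt; apply/negP => lt.
have : 0 < sin (acos p - pi / 2).
  apply: sin_gt0_pi; have := acos_lepi p1; have := @pi_gt0 R; move: lt; lra.
by rewrite sinBpihalf cT oppr_gt0 ltNge p0.
Qed.

End Torus.

(** * The chart of the prism space *)

Section Param.
Variables (R : realType) (r : nat).
Hypothesis r2 : (2 <= r)%N.

Definition unit_angle : R := pi / r%:R.
Local Notation u := unit_angle.

(** The wall [s = 2] becomes the torus [T = pi / 4]. At [s = 0] the quotient [t / (6 * s)] is 0 by
    convention, harmlessly because w vanishes there. *)
Definition cell_point (x : R * R * R) (k : R) : S3 R :=
  let: (a, s, t) := x in
  spolar (pi / 8 * s) (a / 6 * u) ((t / (6 * s) + k) * u).

Lemma r_neq0 : r%:R != 0 :> R. Proof. by rewrite pnatr_eq0; lia. Qed.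

Lemma r_unit : r%:R * u = pi. Proof. by rewrite mulrC divfK// r_neq0. Qed.

Lemma unit_gt0 : 0 < u. Proof. by rewrite divr_gt0 ?pi_gt0// ltr0n; lia. Qed.

Lemma full_turn (n : Z) : zr R n * (pi *+ 2) = zr R n * (2 * r%:R) * u.
Proof. by rewrite -r_unit; ring. Qed.

Lemma spolar_period T A B (m n : Z) :
  spolar T (A + zr R m * (2 * r%:R) * u) (B + zr R n * (2 * r%:R) * u) = spolar
      T A B.
Proof.
apply: val_inj; rewrite /= /qpolar -!full_turn.
have [-> ->] := cos_sin_period A m; by have [-> ->] := cos_sin_period B n.
Qed.

Lemma spolar0 A B B' : spolar 0 A B = spolar 0 A B' :> S3 R.
Proof. by apply: val_inj; rewrite /= /qpolar sin0 !mul0r. Qed.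

Lemma point_period x k (n : Z) : cell_point x (k + zr R n * (2 * r%:R)) =
    cell_point x k.
Proof.
case: x => [[a s] t]; rewrite /cell_point -[RHS](spolar_period _ _ _ 0 n) zr0
    !mul0r addr0.
by congr spolar; ring.
Qed.

Lemma point_translate x y p q k : moved false p q x y ->
  cell_point y (k + zr R p - zr R q) = (expi (zr R p * u) * cell_point x k)%g.
Proof.
case: x => [[a s] t]; case: y => [[a' s'] t'] [-> -> ->]; rewrite /cell_point
    expi_polar.
have [->|s0] := eqVneq s 0.
  by rewrite mulr0; rewrite (spolar0 _ _ 0) [RHS](spolar0 _ _ 0); congr spolar;
      field.
by congr spolar; field.
Qed.

Lemma point_core x k k' : x.1.2 = 0 -> cell_point x k = cell_point x k'.
Proof. by case: x => [[a s] t] /= ->; rewrite /cell_point mulr0; exact: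
    spolar0. Qed.

(** On [T = pi / 4], j sends the angles (A, B) to (pi - B, - A). As pi is r units, a rotation by 1 +
    p + k - r units gives the first angle of y and places the second in the translate
    [k - r + p - q]. *)
Lemma point_flip x y p q k : moved true p q x y ->
  cell_point y (k - r%:R + zr R p - zr R q) =
  (expi ((1 + zr R p + k - r%:R) * u) * (quat_j R * cell_point x k))%g.
Proof.
case: x => [[a s] t]; case: y => [[a' s'] t'] [-> -> a'E ->].
have -> : a' = (12 - t + 12 * zr R p) / 2 by rewrite -a'E; field.
rewrite /cell_point quat_j_polar expi_polar -r_unit.
have -> : r%:R * u / 2 - r%:R * u / 8 * 2 = r%:R * u / 8 * 2 :> R by field.
by congr spolar; field.
Qed.

(** The relations j j = y^r and j y = y^(-1) j bring every element to the form y^n or y^n j. *)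
Lemma dstar_gens_form g : Defs.generated (@dstar_gens R r) g ->
  exists n : Z, g = expi (zr R n * u) \/ g = (expi (zr R n * u) * quat_j R)%g.
Proof.
have jj : (quat_j R * quat_j R)%g = expi (zr R (Z.of_nat r) * u).
  rewrite zr_nat r_unit; apply: val_inj; rewrite /= cospi sinpi.
  by congr (_, _, _, _); ring.
have je x : (quat_j R * expi x)%g = (expi (- x) * quat_j R)%g.
  by apply: val_inj; rewrite /= cosN sinN; congr (_, _, _, _); ring.
have comb m n : (expi (zr R m * u) * expi (zr R n * u))%g = expi (zr R (m +
    n)%zz * u).
  by rewrite expi_mul -mulrDl zrD.
elim=> {g} [g [|] ->||g h _ [m gE] _ [n hE]|g _ [m gE]].
- by exists 0%zz; right; rewrite zr0 mul0r; apply: val_inj; rewrite /= cos0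
    sin0; congr (_, _, _, _); ring.
- by exists 1%zz; left; rewrite zr1 mul1r.
- by exists 0%zz; left; rewrite zr0 mul0r; apply: val_inj; rewrite /= cos0 sin0.
- case: gE hE => -> [] ->.
  + by exists (m + n)%zz; left.
  + by exists (m + n)%zz; right; rewrite mulgA comb.
  + by exists (m - n)%zz; right; rewrite -mulgA je mulgA -mulNr -zrN comb.
  + exists (m - n + Z.of_nat r)%zz; left.
    by rewrite -mulgA (mulgA (quat_j R)) je -!mulgA jj -mulNr -zrN !comb
        Z.add_assoc.
- case: gE => ->.
  + by exists (- m)%zz; left; rewrite expi_inv zrN mulNr.
  + exists (m + Z.of_nat r)%zz; right.
    rewrite zrD zr_nat mulrDl r_unit; apply: val_inj; rewrite /= cosDpi sinDpi.
    by congr (_, _, _, _); ring.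
Qed.

Lemma in_cellP a s t : in_cell ((a, s, t) : R * R * R) <->
  [/\ 0 <= a, a <= 6, s <= 2, 0 <= t & t <= 6 * s].
Proof.
have e0 : zr R 0%zz = 0 by []. have e1 : zr R 1%zz = 1 by [].
have e2 : zr R 2%zz = 2 by []. have e6 : zr R 6%zz = 6 by [].
have n1 : zr R (-1)%zz = -1 := zrN R 1%zz.
split=> [c|[h1 h2 h3 h4 h5] g].
  split.
  - have := c (0, 1, 0, 0)%zz erefl; rewrite /= !e0 e1; lra.
  - have := c (6, -1, 0, 0)%zz erefl; rewrite /= !e0 e6 n1; lra.
  - have := c (2, 0, -1, 0)%zz erefl; rewrite /= !e0 e2 n1; lra.
  - have := c (0, 0, 0, 1)%zz erefl; rewrite /= !e0 e1; lra.
  - have := c (0, 0, 6, -1)%zz erefl; rewrite /= !e0 e6 n1; lra.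
rewrite !inE => /orP[|/orP[|/orP[|/orP[]]]] /eqP-> /=;
  rewrite ?(e0, e1, e2, e6, n1); lra.
Qed.

Lemma expi_generated (n : Z) : Defs.generated (@dstar_gens R r) (expi (zr R n *
    u)).
Proof.
have nat_gen (m : nat) : Defs.generated (@dstar_gens R r) (expi (m%:R * u)).
  elim: m => [|m IHm].
    have -> : expi (0%:R * u) = 1%g by apply: val_inj; rewrite /= mul0r cos0
        sin0.
    exact: Defs.generated_1.
  have -> : expi (m.+1%:R * u) = (expi u * expi (m%:R * u))%g.
    by rewrite expi_mul -natr1; congr expi; ring.
  by apply: Defs.generated_M IHm; apply: Defs.generated_in; right.
have [->|->] : n = Z.of_nat (Z.to_nat n) \/ n = (- Z.of_nat (Z.to_nat (-
    n)))%zz by lia.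
  by rewrite zr_nat.
by rewrite zrN mulNr -expi_inv zr_nat; apply: Defs.generated_V.
Qed.

Lemma quat_j_generated : Defs.generated (@dstar_gens R r) (quat_j R).
Proof. by apply: Defs.generated_in; left. Qed.

Local Open Scope quotient_scope.

Definition chart (x : R * R * R) (k : R) : prism_space R r :=
  \pi_(prism_space R r) (cell_point x k).

Lemma pi_expi (n : Z) q :
  \pi_(prism_space R r) (expi (zr R n * u) * q)%g = \pi_(prism_space R r) q.
Proof.
by apply/esym/prism_space_eqP; exists (expi (zr R n * u)) => //; exact:
    expi_generated.
Qed.

Lemma pi_quat_j q : \pi_(prism_space R r) (quat_j R * q)%g = \pi_(prism_space R
    r) q.
Proof.
by apply/esym/prism_space_eqP; exists (quat_j R) => //; exact: quat_j_generated.
Qed.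

Lemma chart_cases x y k l : chart x k = chart y l ->
  exists n : Z, cell_point y l = (expi (zr R n * u) * cell_point x k)%g \/
                cell_point y l = (expi (zr R n * u) * (quat_j R * cell_point x
                    k))%g.
Proof.
move=> /prism_space_eqP[g /dstar_gens_form[n gE] ->]; exists n.
by case: gE => ->; [left|right; rewrite mulgA].
Qed.

Lemma spolar_injT T A B T' A' B' : 0 <= T <= pi / 2 -> 0 <= T' <= pi / 2 ->
  spolar T A B = spolar T' A' B' :> S3 R -> T = T'.
Proof.
move=> hT hT' /(congr1 val) /= [e1 e2 _ _].
have pi0 := @pi_gt0 R.
have c0 : 0 <= cos T by apply: cos_ge0_pihalf; lra.
have c0' : 0 <= cos T' by apply: cos_ge0_pihalf; lra.
have sq X Y : cos X ^+ 2 = (cos X * cos Y) ^+ 2 + (cos X * sin Y) ^+ 2 :> R.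
  by rewrite !exprMn -mulrDr cos2Dsin2 mulr1.
have /eqP : cos T ^+ 2 = cos T' ^+ 2 by rewrite (sq T A) e1 e2 -sq.
rewrite eqrXn2// => /eqP; apply: cos_inj; rewrite in_itv /=; lra.
Qed.

(** The bound on T keeps [cos T] nonzero, so A is determined modulo a full turn; B is lost only
    where [sin T] vanishes. *)
Lemma spolar_inj T A B A' B' : 0 <= T <= pi / 4 ->
  spolar T A B = spolar T A' B' :> S3 R ->
  (exists n : Z, A = A' + zr R n * (pi *+ 2)) /\
  (T = 0 \/ exists n : Z, B = B' + zr R n * (pi *+ 2)).
Proof.
move=> hT /(congr1 val) /= [e1 e2 e3 e4].
have pi0 := @pi_gt0 R.
have c0 : cos T != 0 by rewrite gt_eqF// cos_gt0_pihalf//; lra.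
split; first by apply: cos_sin_eq; exact: (mulfI c0).
have [->|T0] := eqVneq T 0; [by left|right].
have s0 : sin T != 0.
  by rewrite gt_eqF// sin_gt0_pi//; apply/andP; split; [rewrite lt_def T0|];
      lra.
by apply: cos_sin_eq; exact: (mulfI s0).
Qed.

Lemma angle_bound (s : R) : 0 <= s -> s <= 2 -> 0 <= pi / 8 * s <= pi / 4.
Proof. by have := @pi_gt0 R; nra. Qed.

Lemma chart_translate x y (k l n : Z) : in_cell x -> in_cell y ->
  cell_point y (zr R l) = (expi (zr R n * u) * cell_point x (zr R k))%g ->
  exists p q, moved false p q x y /\
    (x.1.2 = 0 \/ exists m : Z, zr R l = zr R k + zr R p - zr R q + zr R m * (2
        * r%:R)).
Proof.
case: x => [[a s] t]; case: y => [[a' s'] t'] /in_cellP[a0 a6 s2 t0 ts]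
    /in_cellP[a0' a6' s2' t0' ts'].
have pi0 := @pi_gt0 R; have up := unit_gt0; have un := lt0r_neq0 up.
have hs : 0 <= s by lra. have hs' : 0 <= s' by lra.
have bs := angle_bound hs s2; have bs' := angle_bound hs' s2'.
rewrite /cell_point expi_polar => e.
have /(mulfI _) ss : pi / 8 * s' = pi / 8 * s by apply: spolar_injT e; lra.
have {ss} ss : s' = s by apply: ss; rewrite gt_eqF// divr_gt0.
rewrite {s' bs' s2' hs'}ss in e ts' *.
have [[m mE] B] := spolar_inj bs e.
have aE : a' = a + 6 * zr R (n + m * (2 * Z.of_nat r))%zz.
  apply: (mulIf un); rewrite !(zrD, zrM) zr_nat -[zr R 2%zz]/2.
  have -> : a' * u = 6 * (a' / 6 * u) by field.
  by rewrite mE full_turn; field.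
have [s0|s0] := eqVneq s 0.
  exists (n + m * (2 * Z.of_nat r))%zz, 0%zz; split; last by left.
  by split=> //; rewrite s0 zr0 in t0 ts t0' ts' *; lra.
case: B => [/eqP|[m' mE']].
  by rewrite mulf_eq0 (negbTE s0) orbF gt_eqF// divr_gt0.
(* The integers [m] and [m'] count the full turns, of 2 r units each, in the two angles. *)
exists (n + m * (2 * Z.of_nat r))%zz, (n + k - l + m' * (2 * Z.of_nat r))%zz.
have e2 : zr R 2%zz = 2 by [].
split; last first.
  by right; exists (m' - m)%zz; rewrite !(zrD, zrM, zrB) zr_nat e2; ring.
split=> //; rewrite !(zrD, zrM, zrB) zr_nat e2.
have e' : t' / (6 * s) + zr R l = zr R n + (t / (6 * s) + zr R k) + zr R m' *
    (2 * r%:R).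
  by apply: (mulIf un); rewrite mE' full_turn; ring.
have -> : t' = (t' / (6 * s) + zr R l) * (6 * s) - zr R l * (6 * s) by field.
by rewrite e'; field.
Qed.

(** Multiplication by j replaces T by [pi / 2 - T], while cells have [T <= pi / 4]; hence both
    points lie on the boundary torus. *)
Lemma chart_flip x y (k l n : Z) : in_cell x -> in_cell y ->
  cell_point y (zr R l) = (expi (zr R n * u) * (quat_j R * cell_point x (zr R
      k)))%g ->
  x.1.2 = 2.
Proof.
case: x => [[a s] t]; case: y => [[a' s'] t'] /in_cellP[_ _ s2 t0 ts]
    /in_cellP[_ _ s2' t0' ts'].
have pi0 := @pi_gt0 R.
have hs : 0 <= s by lra. have hs' : 0 <= s' by lra.
have bs := angle_bound hs s2; have bs' := angle_bound hs' s2'.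
rewrite /cell_point quat_j_polar expi_polar => /spolar_injT e /=.
have {}e : pi / 8 * s' = pi / 2 - pi / 8 * s by apply: e; lra.
have : pi / 8 * (4 - s - s') = 0 by rewrite !mulrBr e; field.
move/eqP; rewrite mulf_eq0 gt_eqF ?divr_gt0//= => /eqP; lra.
Qed.

(** Apply j if [T > pi / 4]. A power of y then brings the angle of z into one unit, and the floor of
    the resulting angle of w is the index k. *)
Lemma chart_surj (q : S3 R) : exists x (k : Z), in_cell x /\
  \pi_(prism_space R r) q = chart x (zr R k).
Proof.
have pi0 := @pi_gt0 R; have up := unit_gt0; have un := lt0r_neq0 up.
have pin : pi != 0 :> R by rewrite gt_eqF.
have small (T A B : R) : 0 <= T <= pi / 4 -> exists x (k : Z), in_cell x /\
    \pi_(prism_space R r) (spolar T A B) = chart x (zr R k).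
  move=> T4; have [p /andP[p1 p2]] := zr_floor (A / u).
  have [k /andP[k1 k2]] := zr_floor (B / u - zr R p).
  pose s := 8 * T / pi.
  have s0 : 0 <= s by rewrite divr_ge0 ?mulr_ge0 ?pi_ge0//; lra.
  exists (6 * (A / u - zr R p), s, 6 * s * (B / u - zr R p - zr R k)), k; split.
    apply/in_cellP; split; [lra|lra| |apply: mulr_ge0; [lra|lra]|].
      by rewrite ler_pdivrMr//; lra.
    by rewrite -[leRHS]mulr1; apply: ler_wpM2l; lra.
  rewrite -(pi_expi (- p)) expi_polar zrN /chart /cell_point.
  have fT (P : R) : P != 0 -> P / 8 * (8 * T / P) = T by move=> Pn; field.
  rewrite fT//.
  have [T0|T0] := eqVneq T 0.
    rewrite T0; congr \pi; rewrite (spolar0 _ _ 0) [RHS](spolar0 _ _ 0).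
    by congr spolar; field.
  have sn : s != 0 by rewrite /s mulf_neq0 ?mulf_neq0 ?invr_neq0 ?gt_eqF//
      lt_def T0; lra.
  by congr \pi; congr spolar; field; rewrite ?sn ?un.
have [T [A [B [hT ->]]]] := polar_exists q.
have [T4|T4] := leP T (pi / 4); first by apply: small; lra.
by rewrite -pi_quat_j quat_j_polar; apply: small; lra.
Qed.

(** The axis element has half a unit angle, which conjugation doubles. *)
Lemma chart_rotation x k : prism_rotation (chart x k) = chart x (k + 1).
Proof.
rewrite /chart prism_rotationE; congr \pi; case: x => [[a s] t].
rewrite /prism_axis /cell_point conj_polar; congr spolar.
have f (P X Y : R) : Y != 0 -> X * (P / Y) + 2 * (P / (2 * Y)) = (X + 1) * (P /
    Y).
  by move=> Y0; field.
by rewrite /unit_angle natrM f ?r_neq0// addrA.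
Qed.

End Param.

(** * Topology of realizations *)

Local Open Scope classical_set_scope.

Lemma continuous_into_set_type (X Y : topologicalType) (A : set Y) (f : X -> A)
    :
  continuous (fun x => \val (f x)) -> continuous f.
Proof.
move=> /continuousP cf; apply/continuousP => _ [U oU <-].
exact: (cf _ oU).
Qed.

Lemma val_continuous (Y : topologicalType) (A : set Y) :
  continuous (\val : A -> Y).
Proof. exact: initial_continuous. Qed.

Lemma set_type_hausdorff (Y : topologicalType) (A : set Y) :
  hausdorff_space Y -> hausdorff_space A.
Proof.
rewrite !open_hausdorff => hY x y xy.
have /hY[[U V] [/= xU yV] [oU oV UV]] : \val x != \val y by rewrite val_eqE.
exists (\val @^-1` U, \val @^-1` V) => /=.
  by split; rewrite inE; [move: xU|move: yV]; rewrite inE.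
have cv := @val_continuous Y A.
split; [exact: open_comp|exact: open_comp|].
by rewrite -preimage_setI (eqP UV) preimage_set0.
Qed.

Lemma compact_set_type (Y : topologicalType) (A : set Y) :
  compact A -> compact [set: A].
Proof.
move=> cA F PF _.
have FA : (\val @ F) A.
  by apply: (@filterS _ F _ setT) filterT => x _; exact: (set_mem (valP x)).
have [p [Ap cp]] := cA (\val @ F) _ FA.
exists (exist _ p (mem_set Ap)); split=> // B C FB [_ [[W oW <-]] /= Wp WC].
have [_ [[b Bb <-] Wb]] : (\val @` B) `&` W !=set0.
  apply: cp; first by apply: (@filterS _ F _ B) => // b Bb; exists b.
  exact: open_nbhs_nbhs.
by exists b; split=> //; exact: WC.
Qed.

Lemma sum_continuous (R : realType) (X : topologicalType) (I : finType)
    (F : I -> X -> R) :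
  (forall i, continuous (F i)) -> continuous (fun x => \sum_i F i x).
Proof.
move=> cF; apply: (@continuous_big R I +%R 0 xpredT _ X) => // -[a b].
by apply: cvgD; [exact: cvg_fst|exact: cvg_snd].
Qed.

Lemma combination_continuous (R : realType) (X : topologicalType) (I : finType)
    (F : I -> X -> R) (c : I -> R) :
  (forall i, continuous (F i)) -> continuous (fun x => \sum_i F i x * c i).
Proof.
move=> cF; apply: sum_continuous => i x.
by apply: cvgM; [exact: cF|exact: cvg_cst].
Qed.

(** * Closed simplices and compactness of the realization *)

Section Realization.
Variables (R : realType) (V : finType).
Implicit Type K : {set {set V}}.

Lemma evaluation_continuous K (v : V) :
  continuous (fun p : realization R K => \val p v).
Proof.
move=> p; apply: (@continuous_comp _ _ _ (\val : realization R K -> _) (fun f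
    => f v)).
  exact: val_continuous.
exact: proj_continuous.
Qed.

Lemma closed_supported K (s : {set V}) :
  closed [set p : realization R K | forall v, v \notin s -> \val p v = 0].
Proof.
rewrite (_ : [set _ | _] = \bigcap_(v in [set v | v \notin s])
    ((fun p : realization R K => \val p v) @^-1` [set 0])).
  apply: closed_bigI => v _; apply: closed_comp; last exact: closed_eq.
  by move=> p _; exact: evaluation_continuous.
by apply/seteqP; split => p /= H v; exact: H.
Qed.

(** By downward closure the support condition says that p vanishes off some face, a finite union of
    closed conditions. This gives a closed subset of the compact cube. *)
Lemma realization_compact K : (forall s t : {set V}, s \in K -> t \subset s ->
    t != finset.set0 -> t \in K) -> compact [set: realization R K].
Proof.
move=> down; apply: compact_set_type.
have ev_cont (v : V) : continuous (fun p : prod_topology (fun _ : V => R) => p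
    v).
  by move=> p; exact: (@proj_continuous V (fun=> R) v p).
have cube : compact [set p : prod_topology (fun _ : V => R) | forall v, (`[0,
    1]%classic : set R) (p v)].
  by apply: (@tychonoff V (fun=> R) (fun=> `[0, 1]%classic)) => v; exact:
      segment_compact.
apply: (subclosed_compact _ cube).
- have -> : realization R K =
      (\bigcap_(v in [set: V]) ((fun p => p v) @^-1` [set x | 0 <= x])) `&`
      ((fun p => \sum_v p v) @^-1` [set 1]) `&`
      \bigcup_(s in [set s | s \in K])
        \bigcap_(v in [set v | v \notin s]) ((fun p => p v) @^-1` [set 0]).
    apply/seteqP; split => p.
      move=> [p0 p1 pK]; split; [by split=> // v _; exact: p0|].
      exists [set v | p v != 0]%SET => // v /=.
      by rewrite inE negbK => /eqP.
    move=> [[p0 p1] [s sK ps]]; split=> // [v|]; first exact: p0.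
    have supp : [set v | p v != 0]%SET \subset s.
      apply/fintype.subsetP => v; rewrite inE; apply: contraR => vs.
      by apply/eqP/ps.
    apply: down sK supp _; apply/negP => /eqP s0.
    move: p1; rewrite /= big1 => [/eqP|v _]; first by rewrite eq_sym oner_eq0.
    apply/eqP; apply: contraT => pv; have : v \in finset.set0 by rewrite -s0
        inE.
    by rewrite finset.in_set0.
  apply: closedI; first apply: closedI.
  + apply: closed_bigI => v _; apply: closed_comp; last exact: closed_ge.
    by move=> p _; exact: ev_cont.
  + apply: closed_comp; last exact: closed_eq.
    by move=> p _; apply: sum_continuous => v; exact: ev_cont.
  + apply: closed_bigcup; first exact: finite_finset.
    move=> s _; apply: closed_bigI => v _; apply: closed_comp; last exact:
        closed_eq.
    by move=> p _; exact: ev_cont.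
- move=> p [p0 p1 _] v; rewrite /= in_itv /= p0 /= -p1.
  by rewrite (bigD1 v)//= lerDl sumr_ge0.
Qed.

End Realization.

Local Close Scope classical_set_scope.

(** * Continuity of the chart *)

Local Open Scope classical_set_scope.

Section SphereTopology.
Variable R : realType.

Lemma S3_hausdorff : hausdorff_space (S3 R).
Proof. exact/set_type_hausdorff/norm_hausdorff. Qed.

Lemma continuous_quaternion (X : topologicalType) (a b c d : X -> R) :
  continuous a -> continuous b -> continuous c -> continuous d ->
  continuous (fun x => ((a x, b x, c x, d x) : R * R * R * R)).
Proof.
have pair (Y Z : topologicalType) (f : X -> Y) (g : X -> Z) :
    continuous f -> continuous g -> continuous (fun x => (f x, g x)).
  by move=> cf cg x U xU; exact: (cvg_pair (cf x) (cg x)).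
by move=> ca cb cc cd; do 3 (apply: (pair) => //).
Qed.

Lemma continuous_qmul (X : topologicalType) (q : quaternion R) (a b c d : X ->
    R) :
  continuous a -> continuous b -> continuous c -> continuous d ->
  continuous (fun x => qmul q (a x, b x, c x, d x) : R * R * R * R).
Proof.
case: q => [[[x y] z] t] ca cb cc cd /=.
have l u (f : X -> R) p : continuous f -> u * f q @[q --> p] --> u * f p.
  by move=> cf; apply: cvgM; [exact: cvg_cst|exact: cf].
apply: continuous_quaternion => p.
- exact: (cvgB (cvgB (cvgB (l x _ p ca) (l y _ p cb)) (l z _ p cc)) (l t _ p
    cd)).
- exact: (cvgB (cvgD (cvgD (l x _ p cb) (l y _ p ca)) (l z _ p cd)) (l t _ p
    cc)).
- exact: (cvgD (cvgD (cvgB (l x _ p cc) (l y _ p cd)) (l z _ p ca)) (l t _ p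
    cb)).
- exact: (cvgD (cvgB (cvgD (l x _ p cd) (l y _ p cc)) (l z _ p cb)) (l t _ p
    ca)).
Qed.

Lemma lmul_continuous (d : S3 R) : continuous (fun q : S3 R => (d * q)%g).
Proof.
apply: continuous_into_set_type.
pose co (i : R * R * R * R -> R) (q : S3 R) := i (\val q).
have cv : continuous (\val : S3 R -> R * R * R * R) by exact: val_continuous.
have cfst (S T U : topologicalType) (f : S -> T * U) :
    continuous f -> continuous (fun x => (f x).1).
  move=> cf x; apply: (@continuous_comp _ _ _ f fst); first exact: cf.
  by case: (f x) => y z O yO; exact: (@cvg_fst _ _ (nbhs y) (nbhs z) _ O yO).
have csnd (S T U : topologicalType) (f : S -> T * U) :
    continuous f -> continuous (fun x => (f x).2).
  move=> cf x; apply: (@continuous_comp _ _ _ f snd); first exact: cf.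
  by case: (f x) => y z O yO; exact: (@cvg_snd _ _ (nbhs y) (nbhs z) _ O yO).
have cv1 := cfst _ _ _ _ cv; have cv2 := cfst _ _ _ _ cv1.
have c1 : continuous (co (fun p => p.1.1.1)) := cfst _ _ _ _ cv2.
have c2 : continuous (co (fun p => p.1.1.2)) := csnd _ _ _ _ cv2.
have c3 : continuous (co (fun p => p.1.2)) := csnd _ _ _ _ cv1.
have c4 : continuous (co (fun p => p.2)) := csnd _ _ _ _ cv.
rewrite (_ : (fun q : S3 R => _) = (fun q : S3 R => qmul (\val d)
    (co (fun p => p.1.1.1) q, co (fun p => p.1.1.2) q, co (fun p => p.1.2) q,
        co (fun p => p.2) q))).
  exact: continuous_qmul.
by apply/funext => -[[[[x y] z] t] h].
Qed.

(** Where [sin T] vanishes, the last two coordinates are squeezed by its absolute value, whatever B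
    does. *)
Lemma polar_continuous (X : topologicalType) (T A B : X -> R) :
  continuous T -> continuous A -> (forall x, sin (T x) != 0 -> {for x,
      continuous B}) ->
  continuous (fun x => spolar (T x) (A x) (B x)).
Proof.
move=> cT cA cB; apply: continuous_into_set_type => /=.
have ccos (f : X -> R) x : {for x, continuous f} -> {for x, continuous (fun x
    => cos (f x))}.
  by move=> cf; apply: (@continuous_comp _ _ _ f cos) => //; exact:
      continuous_cos.
have csin (f : X -> R) x : {for x, continuous f} -> {for x, continuous (fun x
    => sin (f x))}.
  by move=> cf; apply: (@continuous_comp _ _ _ f sin) => //; exact:
      continuous_sin.
have squeeze (g : R -> R) : (forall y, `|g y| <= 1) ->
    (forall x, {for x, continuous B} -> {for x, continuous (fun x => g (B x))})
        ->
    continuous (fun x => sin (T x) * g (B x)).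
  move=> g1 cg x; have [s0|s0] := eqVneq (sin (T x)) 0; last first.
    by apply: cvgM; [exact/csin/cT|exact/cg/cB].
  rewrite /continuous_at s0 mul0r; apply: norm_cvg0.
  apply: (@squeeze_cvgr _ _ _ _ (cst 0) (fun y => `|sin (T y)|)).
  - near=> y; rewrite normr_ge0 /= normrM -[leRHS]mulr1.
    by rewrite ler_wpM2l.
  - exact: cvg_cst.
  - by rewrite -(normr0 R) -s0; apply: cvg_norm; exact/csin/cT.
apply: continuous_quaternion.
- by move=> x; apply: cvgM; [exact/ccos/cT|exact/ccos/cA].
- by move=> x; apply: cvgM; [exact/ccos/cT|exact/csin/cA].
- by apply: squeeze => [y|x]; [exact: cos_max|exact: ccos].
- by apply: squeeze => [y|x]; [exact: sin_max|exact: csin].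
Unshelve. all: by end_near. Qed.

Lemma point_continuous (r : nat) (k : R) (X : topologicalType) (a s t : X -> R)
    :
  continuous a -> continuous s -> continuous t ->
  continuous (fun x => cell_point r (a x, s x, t x) k).
Proof.
move=> ca cs ct; apply: polar_continuous => [x|x|x].
- by apply: cvgM; [exact: cvg_cst|exact: cs].
- by apply: cvgM; [apply: cvgM|]; [exact: ca|exact: cvg_cst|exact: cvg_cst].
- move=> sx; apply: cvgM; last exact: cvg_cst.
  apply: cvgD; last exact: cvg_cst.
  apply: cvgM; first exact: ct.
  apply: cvgV; last by apply: cvgM; [exact: cvg_cst|exact: cs].
  by apply: contraNneq sx => /eqP; rewrite mulf_eq0 pnatr_eq0 /= => /eqP ->;
      rewrite mulr0 sin0.
Qed.

End SphereTopology.

Local Close Scope classical_set_scope.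

(** * Counting faces *)

Definition faces_of (d : nat) (A : seq nat) : seq (seq nat) :=
  [seq F <- [seq mask [:: m.1.1.1; m.1.1.2; m.1.2; m.2] A |
     m <- [seq (x, y) | x <- [seq (x, y) | x <- [seq (x, y) | x <- [:: true;
         false],
       y <- [:: true; false]], y <- [:: true; false]], y <- [:: true; false]]] |
   size F == d.+1].

Definition sub_label (F G : seq nat) (M : Z) (f : bool) : bool :=
  all (fun i => has (fun j => same_label i j M f) G) F.

Definition apart_label (F G : seq nat) (M : Z) (f : bool) : bool :=
  has (fun i => all (fun j => diff_label i j M f) G) F.

Definition is_core (F : seq nat) : bool := all (fun i => coef (vtype i) == 0%N)
    F.
(** These faces are carried to themselves by the translation by r, so they have half-length
    orbits. *)
Definition is_flipped (F : seq nat) : bool := ~~ is_core F && sub_label F F 0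
    true.

(** Tetrahedra are listed increasingly and the vertices with coefficient 0 come first, so the last
    vertex of a face off the circle w = 0 constrains the translation. *)
Definition common_shifts (F G : seq nat) : seq (Z * bool) :=
  let i := last 0%N F in
  flatten [seq (if vtype i == vtype j then shifts i j else [::]) | j <- G].

Definition same_orbit (F G : seq nat) : bool :=
  has (fun Mf => sub_label F G Mf.1 Mf.2) ((0%zz, false) :: common_shifts F G).

Definition face_reps (d : nat) : seq (seq nat) :=
  foldl (fun s F => if has (same_orbit F) s then s else rcons s F) [::]
    (flatten [seq faces_of d A | A <- tets]).

(** The third condition makes every face a translate of a representative. The fourth makes the
    translates counted by [orbit_length] distinct. *)
Definition reps_check (d : nat) := let s := face_reps d in
  [&& uniq s, all (fun R => has (fun A => R \in faces_of d A) tets) s,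
      all (fun A => all (fun F => has (same_orbit F) s) (faces_of d A)) tets &
      all (fun R => all (fun R' =>
        if is_core R then (R == R') ||
          has (fun i => all (fun j => vtype i != vtype j) R') R
        else (0 < coef (vtype (last 0%N R)))%N && all (fun Mf =>
          apart_label R R' Mf.1 Mf.2 ||
          [&& R == R', (Mf.1 =? 0)%zz & Mf.2 ==> is_flipped R])
          (common_shifts R R')) s) s].

Lemma reps_checkP d : (d < 4)%N -> reps_check d.
Proof. by case: d => [|[|[|[|//]]]] _; vm_compute. Qed.

(* number of orbits of faces of dimension d, of fixed faces among them, and of
   orbits of length r among them *)
Definition reps_count : seq (nat * nat * nat) :=
  [:: (10, 3, 2); (46, 3, 2); (74, 0, 4); (36, 0, 0)]%N.

Lemma reps_countP d : (d < 4)%N -> let s := face_reps d in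
  (size s, count is_core s, count is_flipped s) = nth (0, 0, 0)%N reps_count d.
Proof. by case: d => [|[|[|[|//]]]] _; vm_compute. Qed.

Section Faces.
Variable r : nat.
Hypothesis r2 : (2 <= r)%N.
Local Notation Zn := 'Z_(2 * r).
Implicit Types (F G A : seq nat) (k : Zn).

Definition face F k : {set vertex r} := [set:: [seq label i k | i <- F]].

Definition prism_complex : {set {set vertex r}} :=
  [set s | (s != finset.set0) && has (fun A => [exists k, s \subset face A k])
      tets].

Lemma mem_face F k v : (v \in face F k) = (v \in [seq label i k | i <- F]).
Proof. by rewrite finset.inE. Qed.

Lemma label_face F k i : i \in F -> label i k \in face F k.
Proof. by move=> iF; rewrite mem_face; apply/mapP; exists i. Qed.

Lemma prism_complexP (s : {set vertex r}) : reflect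
  (s != finset.set0 /\ exists A k, A \in tets /\ s \subset face A k) (s \in
      prism_complex).
Proof.
rewrite /prism_complex finset.inE; apply: (iffP andP) => -[s0 H]; split=> //.
  by have /hasP[A At /existsP[k sA]] := H; exists A, k.
by have [A [k [At sA]]] := H; apply/hasP; exists A => //; apply/existsP; exists
    k.
Qed.

Lemma label_tet_inj A k : A \in tets -> {in A &, injective (fun i => label i k
    : vertex r)}.
Proof.
move=> At i j iA jA e; have := allP (allP (allP inj_checkP _ At) _ iA) _ jA.
move=> /orP[/eqP//|/(diff_labelP r2 k)].
by rewrite /label_shift zr0 mul0r !addr0 e eqxx.
Qed.

Lemma tet_uniq A : A \in tets -> uniq A.
Proof. by move=> /(tet_facts rat)[]. Qed.

Lemma tet_size A : A \in tets -> size A = 4%N.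
Proof. by move=> At; apply/eqP; exact: (allP (isT : all (fun A => size A ==
    4%N) tets)). Qed.

Lemma card_face A F k : A \in tets -> subseq F A -> #|face F k| = size F.
Proof.
move=> At FA; rewrite cardsE (card_uniqP _) ?size_map// map_inj_in_uniq.
  exact: subseq_uniq FA (tet_uniq At).
by move=> i j iF jF; apply: (label_tet_inj At); exact: (mem_subseq FA).
Qed.

Lemma faces_ofP d A F : A \in tets ->
  reflect (subseq F A /\ size F = d.+1) (F \in faces_of d A).
Proof.
move=> /tet_size A4; rewrite mem_filter; apply: (iffP andP) => -[].
  move=> /eqP sF /mapP[m _ FE]; split=> //.
  by rewrite FE mask_subseq.
move=> /subseqP[m sm ->] sF; split; first by rewrite sF.
rewrite A4 in sm; case: m sm sF => [|a [|b [|c [|e [|]]]]]// _ _.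
apply/mapP; exists (a, b, c, e) => //.
by case: a; case: b; case: c; case: e.
Qed.

Lemma sub_face F G M f k : sub_label F G M f -> face F k \subset face G (k +
    label_shift r M f).
Proof.
move=> /allP FG; apply/fintype.subsetP => v; rewrite !mem_face => /mapP[i iF
    ->].
by have /hasP[j jG /(same_labelP r2 k) ->] := FG _ iF; exact: map_f.
Qed.

Lemma apart_face F G M f k : apart_label F G M f -> face F k <> face G (k +
    label_shift r M f).
Proof.
move=> /hasP[i iF /allP iG] e.
have : label i k \in face F k by exact: label_face.
rewrite e mem_face => /mapP[j jG ij].
by have := diff_labelP r2 k (iG _ jG); rewrite ij eqxx.
Qed.

Definition orbit_length F : nat := if is_core F then 1%N else if is_flipped F
    then r else (2 * r)%N.

(** Compared with 2 r, a flipped orbit lacks r faces and a fixed face lacks 2 r - 1; the equation is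
    arranged to avoid subtraction. *)
Lemma sum_orbit_length (s : seq (seq nat)) :
  (\sum_(F <- s) orbit_length F + count is_flipped s * r + count is_core s * (2
      * r) =
   count is_core s + size s * (2 * r))%N.
Proof.
elim: s => [|F s IHs]; first by rewrite big_nil.
rewrite big_cons /=; move: IHs; set S := (\sum_(G <- s) _)%N => IHs.
have : (orbit_length F + is_flipped F * r + is_core F * (2 * r) = is_core F + 2
    * r)%N.
  by rewrite /orbit_length /is_flipped; case: (is_core F); case: (sub_label _ _
      _ _) => /=; lia.
by rewrite !mulnDl mulSn; lia.
Qed.

Lemma core_face F k l : is_core F -> face F k = face F l.
Proof.
move=> /allP cF; rewrite /face.
have -> // : [seq label i k | i <- F] = [seq label i l | i <- F].
apply/eq_in_map => i /cF /eqP c0.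
by apply/eqP; rewrite label_eq eqxx c0 mulr0n.
Qed.

(** The map [phi] puts pairs of a representative and a translate number below its orbit length in
    bijection with the faces of dimension d. *)
Lemma prism_face_count d : (d < 4)%N ->
  face_count prism_complex d = (\sum_(F <- face_reps d) orbit_length F)%N.
Proof.
move=> d4; have /and4P[us /allP repT /allP repS /allP repI] := reps_checkP d4.
set s := face_reps d in us repT repS repI *.
have length_le F : (orbit_length F <= 2 * r)%N by rewrite /orbit_length; case:
    ifP => _; [|case: ifP => _]; lia.
have repF R : R \in s -> exists2 A, A \in tets & subseq R A /\ size R = d.+1.
  move=> /repT/hasP[A At] /(faces_ofP d R At)[RA sR]; by exists A.
pose phi (p : 'I_(size s) * 'I_(2 * r)) := face (nth [::] s p.1) (p.2%:R : Zn).
pose X := [set p : 'I_(size s) * 'I_(2 * r) | (p.2 < orbit_length (nth [::] s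
    p.1))%N].
have Xcard : #|X| = (\sum_(F <- s) orbit_length F)%N.
  rewrite (big_nth [::]) big_mkord -sum1_card.
  rewrite (eq_bigl (fun p : 'I_(size s) * 'I_(2 * r) => true && (p.2 <
      orbit_length (nth [::] s p.1))%N)); last first.
    by move=> p; rewrite finset.inE.
  rewrite -(pair_big_dep xpredT (fun (i : 'I_(size s)) (k : 'I_(2 * r)) => (k <
      orbit_length (nth [::] s i))%N) (fun _ _ => 1%N)) /=.
  by apply: eq_bigr => i _; rewrite (big_ord_narrow (length_le _)) sum1_card
      card_ord.
have ord_val (k : 'I_(2 * r)) : ((k%:R : Zn) : nat) = k.
  by rewrite val_Zp_nat ?n_gt1// modn_small.
have -> : face_count prism_complex d = #|phi @: X|.
  apply: eq_card => t; rewrite finset.inE; apply/andP/imsetP => [[]|[p]].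
    move=> /prism_complexP[t0 [A [k [At tA]]]] /eqP td.
    pose F := [seq i <- A | label i k \in t].
    have FA : subseq F A by exact: filter_subseq.
    have tF : t = face F k.
      apply/setP => v; rewrite mem_face; apply/idP/mapP => [vt|[i]].
        have := fintype.subsetP tA _ vt; rewrite mem_face => /mapP[i iA vi].
        by exists i => //; rewrite mem_filter -vi vt.
      by rewrite mem_filter => /andP[it _] ->.
    have sF : size F = d.+1 by rewrite -(card_face k At FA) -tF.
    have Fd : F \in faces_of d A by apply/faces_ofP.
    have /hasP[R Rs /hasP[Mf _ FR]] := allP (repS _ At) _ Fd.
    have [B Bt [RB sR]] := repF _ Rs.
    pose l := k + label_shift r Mf.1 Mf.2.
    have tR : t = face R l.
      have tl : t \subset face R l by rewrite tF; exact: sub_face.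
      by apply/eqP; rewrite eqEcard tl td (card_face _ Bt RB) sR leqnn.
    (* The translate number is reduced to 0 for a fixed face and modulo r for a flipped one. *)
    have [m mR tm] : exists2 m : 'I_(2 * r), (m < orbit_length R)%N & t = face
        R (m%:R).
      have l2r : (l < 2 * r)%N by rewrite -[X in (_ < X)%N](Zp_cast (n_gt1 r2)).
      rewrite /orbit_length; have [cR|cR] := boolP (is_core R).
        have r0 : (0 < 2 * r)%N := ltnW (n_gt1 r2).
        by exists (Ordinal r0) => //; rewrite tR; exact: core_face.
      case: ifP => [/andP[_ fR]|_]; last first.
        by exists (Ordinal l2r) => //; rewrite tR; exact: (congr1 (face R)
            (esym (natr_Zp l))).
      have flip k' : face R k' = face R (k' + r%:R).
        apply/eqP; rewrite eqEcard !(card_face _ Bt RB) leqnn andbT.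
        by have := sub_face k' fR; rewrite /label_shift zr0 add0r mul1r.
      have [lr|lr] := ltnP l r.
        by exists (Ordinal l2r) => //; rewrite tR; exact: (congr1 (face R)
            (esym (natr_Zp l))).
      have lr2 : (l - r < 2 * r)%N by exact: leq_ltn_trans (leq_subr _ _) l2r.
      exists (Ordinal lr2); first by rewrite /= ltn_subLR// addnn -mul2n.
            rewrite tR [RHS]flip -natrD subnK//; exact: (congr1 (face R) (esym
                (natr_Zp l))).
    have iR : (index R s < size s)%N by rewrite index_mem.
    by exists (Ordinal iR, m); rewrite ?finset.inE /phi /= nth_index.
  rewrite finset.inE => pX ->; have Rs : nth [::] s p.1 \in s by rewrite
      mem_nth.
  have [B Bt [RB sR]] := repF _ Rs.
  rewrite /phi (card_face _ Bt)// sR eqxx; split=> //.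
  apply/prism_complexP; split.
    by rewrite -card_gt0 (card_face _ Bt)// sR.
  exists B, p.2%:R; split=> //; apply/fintype.subsetP => v; rewrite !mem_face.
  by move=> /mapP[i iR ->]; apply/mapP; exists i => //; exact: (mem_subseq RB).
rewrite card_in_imset// => -[c k] [c' k']; rewrite !finset.inE /phi /=.
set R := nth [::] s c; set R' := nth [::] s c' => kR kR' e.
have Rs : R \in s by rewrite mem_nth. have Rs' : R' \in s by rewrite mem_nth.
have RR : R = R' -> c = c'.
  by move=> /eqP; rewrite nth_uniq// => /eqP/val_inj.
have := allP (repI _ Rs) _ Rs'; have [cR|cR] := boolP (is_core R).
  move=> /orP[/eqP E|/hasP[i iR /allP iR']].
    rewrite -(RR E); move: kR kR'; rewrite -E /orbit_length cR !ltnS !leqn0 =>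
        /eqP k0 /eqP k0'.
    by congr (_, _); apply: val_inj; rewrite /= k0 k0'.
  have : label i k%:R \in face R k%:R by exact: label_face.
  rewrite e mem_face => /mapP[j /iR' /negP + /eqP].
  by rewrite label_eq => + /andP[].
move=> /andP[c0 /allP H].
have lR : last 0%N R \in R.
  have [A _ [_ sR]] := repF _ Rs; by case: (R) sR => //= x l _; exact: mem_last.
have : label (last 0%N R) k%:R \in face R k%:R by exact: label_face.
rewrite e mem_face => /mapP[j jR' lj].
have [tj [Mf Mfs kE]] := shiftsP r2 c0 lj.
have /H/orP[ap|/and3P[/eqP E /Z.eqb_spec M0 fl]] : Mf \in common_shifts R R'.
    apply/flattenP; exists (shifts (last 0%N R) j) => //.
    by apply/mapP; exists j; rewrite // tj eqxx.
  by have := @apart_face R R' Mf.1 Mf.2 k%:R ap; rewrite -kE e.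
rewrite -(RR E); congr (_, _); apply: val_inj => /=; move: kE kR kR' fl.
rewrite -E /orbit_length (negbTE cR) /label_shift M0 zr0 add0r; case: Mf.2 =>
    /=.
  (* A shift by r contradicts that both translate numbers of a flipped face are below r. *)
  rewrite mul1r -natrD => kE kR kR' /= fl; move: kR kR'; rewrite fl => kr kr'.
  have := ltn_add2r r k r; rewrite kr addnn -mul2n => kr2.
  have e' : (k' : nat) = (k + r)%N.
    by have := congr1 (@nat_of_ord _) kE; rewrite ord_val val_Zp_nat ?n_gt1//
        modn_small.
  by move: kr'; rewrite e' ltnNge leq_addl.
rewrite mul0r addr0 => kE _ _ _.
by have := congr1 (@nat_of_ord _) kE; rewrite !ord_val.
Qed.

End Faces.

(** * Points of the cells and points of the prism space *)

Lemma walls_check : all (fun g => all (fun i => (0 <=? evz g (vpos i))%zz)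
    (iota 0 25)) walls.
Proof. by vm_compute. Qed.

Lemma zr_inj (R : numDomainType) : injective (zr R).
Proof.
move=> m n e; have [mn|[//|mn]] : ((m <? n) \/ (m = n) \/ (n <? m))%zz by lia.
  by have := @zr_lt R _ _ mn; rewrite e ltxx.
by have := @zr_lt R _ _ mn; rewrite e ltxx.
Qed.

Section Walls.
Variable R : realFieldType.

Lemma wall_ge0 g (i : 'I_25) : g \in walls -> 0 <= zr R (evz g (vpos i)).
Proof.
move=> gw; apply: (@zr_le R 0%zz).
by have := allP (allP walls_check _ gw) i; rewrite mem_iota ltn_ord => ->.
Qed.

Lemma bary_in_cell A (w : 'I_25 -> R) : weights A w -> in_cell (bary w).
Proof.
move=> [w0 w1 _] g gw; rewrite ev_bary//; apply: sumr_ge0 => i _.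
by rewrite mulr_ge0// wall_ge0.
Qed.

(** Wall functions are nonnegative at all vertices, so a vanishing weighted sum vanishes term by
    term. *)
Lemma bary_wall A (w : 'I_25 -> R) g : weights A w -> g \in walls ->
  ev g (bary w) = 0 -> forall i : 'I_25, w i != 0 -> evz g (vpos i) = 0%zz.
Proof.
move=> [w0 w1 _] gw; rewrite ev_bary// => /eqP.
rewrite psumr_eq0; last by move=> i _; rewrite mulr_ge0// wall_ge0.
move=> /allP H i wi; have := H i (mem_index_enum i).
by rewrite /= mulf_eq0 (negbTE wi) => /eqP e; apply: (@zr_inj R).
Qed.

Lemma moved_trans p q p' q' (x y z : R * R * R) :
  moved false p q x y -> moved false p' q' y z ->
  moved false (p + p') (q + q') x z.
Proof.
case: x => [[a s] t]; case: y => [[a' s'] t']; case: z => [[a'' s''] t''].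
by move=> [-> -> ->] [-> -> ->]; rewrite /moved !zrD; split=> //; ring.
Qed.

Lemma moved_sym p q (x y : R * R * R) : moved false p q x y -> moved false (-
    p) (- q) y x.
Proof.
case: x => [[a s] t]; case: y => [[a' s'] t'] [-> -> ->].
by rewrite /moved !zrN; split=> //; ring.
Qed.

End Walls.

(** * Independence of the chart from the tetrahedron representing a point *)

Section Charts.
Variables (R : realType) (r : nat).
Hypothesis r2 : (2 <= r)%N.
Local Notation Zn := 'Z_(2 * r).
Implicit Types (w : 'I_25 -> R) (k : Zn).
Local Notation zn k := (Z.of_nat (nat_of_ord k)).

Lemma zr_zn k : zr Zn (zn k) = k.
Proof. by rewrite zr_nat natr_Zp. Qed.

Lemma zr_2r : zr Zn (2 * Z.of_nat r)%zz = 0.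
Proof. by rewrite zrM zr_nat -[zr Zn 2%zz]/(2%:R) mulr_natl Zn_r2. Qed.

Lemma zr_turn (m : Z) : zr Zn (m * (2 * Z.of_nat r))%zz = 0.
Proof. by rewrite zrM zr_2r mulr0. Qed.

Lemma zn_lift (a b : Z) : zr Zn a = zr Zn b ->
  exists m : Z, a = (b + m * (2 * Z.of_nat r))%zz.
Proof.
move=> e; have /(zrZn_eq0 r2)[m mE] : zr Zn (a - b) = 0 by rewrite zrB e subrr.
by exists m; move: mE; lia.
Qed.

Lemma turnE (m : Z) : zr R (m * (2 * Z.of_nat r))%zz = zr R m * (2 * r%:R).
Proof. by rewrite !zrM zr_nat. Qed.

Lemma chart_congr x (a b : Z) : zr Zn a = zr Zn b ->
  chart r x (zr R a) = chart r x (zr R b).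
Proof. by move=> /zn_lift[m ->]; rewrite zrD turnE /chart point_period. Qed.

Lemma shiftE (M : Z) (f : bool) :
  label_shift r M f = zr Zn (M + (if f then Z.of_nat r else 0))%zz.
Proof. exact: shift_Z. Qed.

(** The move supplied by [push_moved] is realized by a group element, through [point_translate] or
    [point_flip], and the projection forgets it. *)
Lemma chart_push A B w w' k k' : A \in tets -> B \in tets ->
  weights A w -> weights B w' -> push w k =1 push w' k' ->
  chart r (bary w) (zr R (zn k)) = chart r (bary w') (zr R (zn k')).
Proof.
move=> At Bt wA wB /(push_moved r2 At Bt wA wB)[f [p [q [mv kk]]]].
have eqk : k' = k + label_shift r (p - q) f -> forall a : Z,
    zr Zn a = zr Zn (zn k + (p - q) + (if f then Z.of_nat r else 0))%zz ->
    chart r (bary w') (zr R (zn k')) = chart r (bary w') (zr R a).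
  move=> e a ae; apply: chart_congr; rewrite ae zr_zn e shiftE !zrD zr_zn; ring.
case: f mv kk eqk => mv kk eqk.
  have {}kk : k' = k + label_shift r (p - q) true by case: kk => [|[]].
  (* The flip adds r to the label but subtracts it in [point_flip]; the two agree modulo 2 r. *)
  rewrite (eqk kk (zn k - Z.of_nat r + p - q)%zz); last first.
    apply/eqP; rewrite -subr_eq0 -zrB -(zr_turn (-1)); apply/eqP; congr zr; lia.
  have := point_flip r2 (zr R (zn k)) mv; rewrite /chart !zrB zrD zrB !zr_nat
      => ->.
  have -> : 1 + zr R p + (k : nat)%:R - r%:R = zr R (1 + p + zn k - Z.of_nat
      r)%zz.
    by rewrite zrB !zrD !zr_nat.
  by rewrite pi_expi// pi_quat_j// zr_nat.
have -> : chart r (bary w') (zr R (zn k')) = chart r (bary w') (zr R (zn k + p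
    - q)%zz).
  case: kk => [kk|[_ s0]].
    by apply: eqk => //; rewrite Z.add_0_r Z.add_sub_assoc.
  rewrite /chart; congr (\pi_(_))%qT; apply: point_core.
  by move: mv s0; case: (bary w) => [[a s] t]; case: (bary w') => [[a' s'] t']
      /= [_ -> _].
have := point_translate r (zr R (zn k)) mv; rewrite /chart zrB zrD => ->.
by rewrite pi_expi.
Qed.

End Charts.

(** * Separation of points by the chart *)

Section Injective.
Variables (R : realType) (r : nat).
Hypothesis r2 : (2 <= r)%N.
Local Notation Zn := 'Z_(2 * r).
Implicit Types (w : 'I_25 -> R) (k : Zn).
Local Notation zn k := (Z.of_nat (nat_of_ord k)).

(** Applied to a on [0, 6] and t on [0, 6 s]: a translation between points of the cell is trivial in
    that coordinate or joins opposite walls. *)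
Lemma int_small (p : Z) (a b c : R) : 0 < c -> 0 <= a -> a <= c -> 0 <= b -> b
    <= c ->
  b = a + c * zr R p ->
  [\/ p = 0%zz, [/\ p = 1%zz, a = 0 & b = c] | [/\ p = (-1)%zz, a = c & b = 0]].
Proof.
move=> c0 a0 ac b0 bc e.
have pc : (p <= 1)%zz.
  rewrite Z.le_ngt => lt; have : zr R 2%zz <= zr R p by apply: zr_le; lia.
  by rewrite -[zr R 2%zz]/2 => ?; nra.
have pc' : (-1 <= p)%zz.
  rewrite Z.le_ngt => lt; have : zr R p <= zr R (-2)%zz by apply: zr_le; lia.
  by rewrite [zr R (-2)%zz](zrN R 2) -[zr R 2%zz]/2 => ?; nra.
have [?|[?|?]] : (p = 0 \/ p = 1 \/ p = -1)%zz by lia.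
- by constructor 1.
- by constructor 2; subst p; rewrite zr1 in e; split; lra.
- by constructor 3; subst p; rewrite [zr R _](zrN R 1) zr1 in e; split; lra.
Qed.

(** All vertices have nonnegative s, so only those with s = 0 carry weight, and their labels ignore
    k. *)
Lemma core_push A w k k' : weights A w -> (bary w).1.2 = 0 -> push w k =1 push
    w k'.
Proof.
move=> [w0 w1 _] s0 v; rewrite !pushE; apply: eq_bigr => i _; apply: eq_mull =>
    wi.
suff -> : label i k = label i k' by [].
have /eqP := s0; rewrite /bary /= psumr_eq0; last first.
  move=> j _; rewrite mulr_ge0//; apply: (@zr_le R 0%zz).
  by have := allP (isT : all (fun j => (0 <=? (vpos j).1.2)%zz) (iota 0 25)) j;
      rewrite mem_iota ltn_ord => ->.
move=> /allP/(_ i (mem_index_enum i)); rewrite /= mulf_eq0 (negbTE wi) => /eqP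
    e.
have si : (vpos i).1.2 = 0%zz by apply: (@zr_inj R).
have := allP (isT : all (fun j => ((vpos j).1.2 =? 0)%zz ==> (coef (vtype j) ==
    0%N)) (iota 0 25)) i.
rewrite mem_iota ltn_ord si => /(_ isT) /= /eqP c0.
by apply/eqP; rewrite label_eq eqxx c0 mulr0n.
Qed.

Lemma push_eq A B w w' k : A \in tets -> B \in tets -> weights A w -> weights B
    w' ->
  bary w = bary w' -> push w k =1 push w' k.
Proof.
move=> At Bt wA wB e v; rewrite !pushE; apply: eq_bigr => i _.
by rewrite (bary_inj At Bt wA wB e).
Qed.

Lemma shift_sum k (M N : Z) :
  k + label_shift r M false + label_shift r N false = k + label_shift r (M + N)
      false.
Proof. by rewrite /label_shift !mul0r !addr0 zrD addrA. Qed.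

(** By [bary_wall] only vertices on the wall carry weight, so the verified gluing of that wall
    applies. *)
Lemma cross_a A w k : A \in tets -> weights A w -> (bary w).1.1 = 6 ->
  exists B w', [/\ B \in tets, weights B w', moved false (-1) 0 (bary w) (bary
      w') &
    push w k =1 push w' (k + label_shift r (-1) false)].
Proof.
move=> At wA a6; apply: (move_weights r2 k move_check_a At wA) => i wi.
have := bary_wall wA (isT : (6, -1, 0, 0)%zz \in walls) _ wi.
move: a6; case: (bary w) => [[a s] t] /= ->.
rewrite [zr R (-1)](zrN R 1) zr0 zr1 -[zr R 6%zz]/6 !mul0r !addr0 mulN1r subrr
    => /(_ erefl).
by case: (vpos i) => [[x y] z] /= ?; apply/Z.eqb_spec; lia.
Qed.

Lemma cross_t A w k : A \in tets -> weights A w -> (bary w).2 = 6 * (bary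
    w).1.2 ->
  exists B w', [/\ B \in tets, weights B w', moved false 0 (-1) (bary w) (bary
      w') &
    push w k =1 push w' (k + label_shift r 1 false)].
Proof.
move=> At wA a6; apply: (move_weights r2 k move_check_t At wA) => i wi.
have := bary_wall wA (isT : (0, 0, 6, -1)%zz \in walls) _ wi.
move: a6; case: (bary w) => [[a s] t] /= ->.
rewrite [zr R (-1)](zrN R 1) zr0 zr1 -[zr R 6%zz]/6 !mul0r !add0r mulN1r subrr
    => /(_ erefl).
by case: (vpos i) => [[x y] z] /= ?; apply/Z.eqb_spec; lia.
Qed.

Lemma cross_s A w k : A \in tets -> weights A w -> (bary w).1.2 = 2 ->
  exists B w', [/\ B \in tets, weights B w', moved true 0 0 (bary w) (bary w') &
    push w k =1 push w' (k + label_shift r 0 true)].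
Proof.
move=> At wA a6; apply: (move_weights r2 k move_check_s At wA) => i wi.
have := bary_wall wA (isT : (2, 0, -1, 0)%zz \in walls) _ wi.
move: a6; case: (bary w) => [[a s] t] /= ->.
rewrite [zr R (-1)](zrN R 1) zr0 zr1 -[zr R 2%zz]/2 !mul0r !addr0 mulN1r subrr
    => /(_ erefl).
by case: (vpos i) => [[x y] z] /= ?; apply/Z.eqb_spec; lia.
Qed.

(** For s > 0 only q = 0, 1 or -1 can occur. One crossing of the wall [t = 6 s] undoes the
    translation, after which the barycenters coincide. *)
Lemma push_translate_t A B w w' k k' q : A \in tets -> B \in tets ->
  weights A w -> weights B w' -> moved false 0 q (bary w) (bary w') ->
  (bary w).1.2 = 0 \/ k' = k + label_shift r (- q) false ->
  push w k =1 push w' k'.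
Proof.
move=> At Bt wA wB mv kk v.
have cw := bary_in_cell wA; have cw' := bary_in_cell wB.
have [s0|s0] := eqVneq (bary w).1.2 0.
  have e : bary w = bary w'.
    move: cw cw' mv s0; case: (bary w) => [[a s] t]; case: (bary w') => [[a'
        s'] t'].
    move=> _ _ [-> -> ->] /= ->; rewrite zr0.
    by congr (_, _, _); ring.
  rewrite (push_eq k At Bt wA wB e); apply: core_push wB _ _.
  by rewrite -e.
have {}kk : k' = k + label_shift r (- q) false by case: kk s0 => [->|//];
    rewrite eqxx.
have [q0|[q1 t0 t6]|[q1 t0 t6]] : [\/ q = 0%zz,
    [/\ q = 1%zz, (bary w).2 = 0 & (bary w').2 = 6 * (bary w').1.2] |
    [/\ q = (-1)%zz, (bary w).2 = 6 * (bary w).1.2 & (bary w').2 = 0]].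
  move: mv cw cw' s0; case: (bary w) => [[a s] t]; case: (bary w') => [[a' s']
      t'] /=.
  move=> [_ -> tE] /in_cellP[_ _ _ t0 ts] /in_cellP[_ _ _ t0' ts'] s0.
  apply: int_small => //; first by rewrite lt_def mulf_neq0 ?pnatr_eq0//=; lra.
  by rewrite tE; ring.
- have e : bary w = bary w'.
    move: mv; case: (bary w) => [[a s] t]; case: (bary w') => [[a' s'] t'].
    by move=> [-> -> ->]; rewrite q0 zr0; congr (_, _, _); ring.
  rewrite (push_eq k At Bt wA wB e) kk q0 /label_shift zr0 mul0r !addr0.
  by [].
- have [C [w'' [Ct wC mv' ->]]] := cross_t k' Bt wB t6.
  rewrite kk q1 shift_sum /label_shift zr0 mul0r !addr0; apply: (push_eq _ At
      Ct wA wC).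
  have := moved_trans mv mv'; rewrite q1.
  case: (bary w) => [[a s] t]; case: (bary w'') => [[a' s'] t'] [-> -> ->].
  by rewrite zr0; congr (_, _, _); ring.
have [C [w'' [Ct wC mv' ->]]] := cross_t k At wA t0.
rewrite kk q1; apply: (push_eq _ Ct Bt wC wB).
have := moved_trans (moved_sym mv') mv; rewrite q1.
case: (bary w') => [[a s] t]; case: (bary w'') => [[a' s'] t'] [-> -> ->].
by rewrite zr0; congr (_, _, _); ring.
Qed.

Lemma push_translate A B w w' k k' p q : A \in tets -> B \in tets ->
  weights A w -> weights B w' -> moved false p q (bary w) (bary w') ->
  (bary w).1.2 = 0 \/ k' = k + label_shift r (p - q) false ->
  push w k =1 push w' k'.
Proof.
move=> At Bt wA wB mv kk v.
have cw := bary_in_cell wA; have cw' := bary_in_cell wB.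
have [p0|[p1 a0 a6]|[p1 a0 a6]] : [\/ p = 0%zz,
    [/\ p = 1%zz, (bary w).1.1 = 0 & (bary w').1.1 = 6] |
    [/\ p = (-1)%zz, (bary w).1.1 = 6 & (bary w').1.1 = 0]].
  move: mv cw cw'; case: (bary w) => [[a s] t]; case: (bary w') => [[a' s'] t']
      /=.
  move=> [aE _ _] /in_cellP[a0 a6 _ _ _] /in_cellP[a0' a6' _ _ _].
  exact: int_small.
- by rewrite p0 in mv kk; exact: (push_translate_t At Bt wA wB mv kk).
- have [C [w'' [Ct wC mv' ->]]] := cross_a k' Bt wB a6.
  have := moved_trans mv mv'; rewrite p1 Z.add_0_r => mv''.
  apply: (push_translate_t At Ct wA wC mv'').
  case: kk => [|->]; [by left|right]; rewrite shift_sum p1; congr (_ +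
      label_shift _ _ _); lia.
have [C [w'' [Ct wC mv' ->]]] := cross_a k At wA a0.
have := moved_trans (moved_sym mv') mv; rewrite p1 => mv''.
apply: (push_translate_t Ct Bt wC wB mv'').
case: kk => [s0|->]; [left|right].
  by move: mv' s0; case: (bary w) => [[a s] t]; case: (bary w'') => [[a' s']
      t'] /= [_ -> _].
by rewrite shift_sum p1; congr (_ + label_shift _ _ _); lia.
Qed.

(** A power of y acts as a translation. If j is involved, the point lies on [s = 2], and crossing
    that wall first leaves only a power of y. *)
Lemma push_of_chart A B w w' k k' : A \in tets -> B \in tets ->
  weights A w -> weights B w' ->
  chart r (bary w) (zr R (zn k)) = chart r (bary w') (zr R (zn k')) ->
  push w k =1 push w' k'.
Proof.
move=> At Bt wA wB e.
have cw := bary_in_cell wA; have cw' := bary_in_cell wB.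
have interpolation (K L : Z) (p q : Z) x : (x = 0 :> R \/ exists m : Z, zr R L
    = zr R K + zr R p - zr R q + zr R m * (2 * r%:R)) ->
    x = 0 \/ zr Zn L = zr Zn K + label_shift r (p - q) false.
  move=> [->|[m mE]]; [by left|right].
  have : zr R L = zr R (K + p - q + m * (2 * Z.of_nat r))%zz.
    by rewrite mE !(zrD, zrM, zrB) zr_nat.
  by move=> /(@zr_inj R) ->; rewrite zrD zr_turn// !(zrB, zrD) /label_shift zrB
      mul0r !addr0 addrA.
have [n [tr|fl]] := chart_cases r2 e.
  have [p [q [mv kk]]] := chart_translate r2 cw cw' tr.
  apply: (push_translate At Bt wA wB mv).
  by have := interpolation _ _ _ _ _ kk; rewrite !zr_zn.
have s2 := chart_flip cw cw' fl.
have [C [w'' [Ct wC mv ew]]] := cross_s k At wA s2.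
have cw'' := bary_in_cell wC.
move=> v; rewrite ew.
have pf := point_flip r2 (zr R (zn k)) mv.
have tr : cell_point r (bary w') (zr R (zn k')) =
    (expi (zr R (n - (1 + zn k - Z.of_nat r)) * unit_angle R r) *
     cell_point r (bary w'') (zr R (zn k - Z.of_nat r)))%g.
  have -> : zr R (zn k - Z.of_nat r)%zz = zr R (zn k) - r%:R + zr R 0 - zr R 0.
    by rewrite zrB !zr_nat zr0 subr0 addr0.
  rewrite pf mulgA expi_mul fl; congr (expi _ * _)%g.
  by rewrite !(zrB, zrD) zr0 zr1 !zr_nat; ring.
have [p [q [mv' kk]]] := chart_translate r2 cw'' cw' tr.
apply: (push_translate Ct Bt wC wB mv').
have := interpolation _ _ _ _ _ kk; rewrite zr_zn => -[->|->]; [by left|right].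
by rewrite zrB zr_zn zr_nat /label_shift zr0 mul0r mul1r !addr0 add0r r_opp.
Qed.

End Injective.

(** * The action *)

Local Open Scope classical_set_scope.

Section Action.
Variable r : nat.
Hypothesis r2 : (2 <= r)%N.
Local Notation Zn := 'Z_(2 * r).

Lemma turn_ok (v : vertex r) (a : Zn) :
  vertex_ok ((\val v).1, (\val v).2 + a *+ coef (\val v).1).
Proof.
by case: v => -[t x] /= /existsP[y /eqP /= ->]; apply/existsP; exists (y + a);
    rewrite /= mulrnDl.
Qed.

Definition turn (v : vertex r) (a : Zn) : vertex r := exist (@vertex_ok r) _
    (turn_ok v a).

Lemma turn0 : turn^~ 1%g =1 id.
Proof. by move=> [[t x] vok]; apply: val_inj; rewrite /= mul0rn addr0. Qed.

Lemma turnD v : act_morph turn v.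
Proof. by case: v => [[t x] vok] a b; apply: val_inj; rewrite /= mulrnDl addrA.
    Qed.

Definition turn_action : {action Zn &-> vertex r} := TotalAction turn0 turnD.

Lemma turn_label i (k a : Zn) : turn (label i k) a = label i (k + a).
Proof. by apply: val_inj; rewrite /= -mulrnDl addrA. Qed.

Lemma prism_simplicial_complex : simplicial_complex (prism_complex r).
Proof.
split.
- by apply/negP => /prism_complexP[]; rewrite eqxx.
- move=> v; apply/prism_complexP; split; first by rewrite -cards_eq0 cards1.
  have [i [A [At iA iv]]] : exists i A, [/\ A \in tets, i \in A & vtype i =
      (\val v).1].
    have : has (fun A => has (fun i => vtype i == (\val v).1) A) tets.
      by move: ((\val v).1) => [t tl]; move: tl; do 10 (case: t => [|t] //).
    by move=> /hasP[A At /hasP[i iA /eqP]]; exists i, A.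
  case: v iv => -[t x] /= vok iv; have /existsP[y /eqP /= xE] := vok.
  exists A, (y - label_shift r (vshift i) (vflip i)); split=> //.
  rewrite finset.sub1set mem_face; apply/mapP; exists i => //; apply: val_inj
      => /=.
  by rewrite addrC subrK iv inord_val -xE.
- move=> s t /prism_complexP[_ [A [k [At sA]]]] ts t0; apply/prism_complexP.
  by split=> //; exists A, k; split=> //; exact: fintype.subset_trans sA.
Qed.

Lemma turn_face A (k a : Zn) (s : {set vertex r}) : s \subset face A k ->
  [set turn v a | v in s]%SET \subset face A (k + a).
Proof.
move=> sA; apply/fintype.subsetP => _ /imsetP[v /(fintype.subsetP sA) + ->].
rewrite !mem_face => /mapP[i iA ->]; rewrite turn_label; apply/mapP; by exists
    i.
Qed.

Lemma turn_simplicial : simplicial_action (prism_complex r) turn_action.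
Proof.
move=> a s /prism_complexP[s0 [A [k [At sA]]]]; apply/prism_complexP; split.
  by rewrite -cards_eq0 card_imset ?cards_eq0//; exact: act_inj.
by exists A, (k + a); split=> //; exact: turn_face.
Qed.

Lemma turn_effective : effective_action turn_action.
Proof.
apply/fintype.subsetP => a /setIP[_ /astabP fix_a].
rewrite finset.inE; apply/eqP.
(* Vertex 4 has coefficient 1, so its label is moved by every nonzero a. *)
have := fix_a (label 4 0) (finset.in_setT _); rewrite /= turn_label => /eqP.
rewrite label_eq eqxx (_ : coef (vtype 4) = 1%N)// mulr1n /=.
set x := label_shift _ _ _; have -> : x + (0 + a) - (x + 0) = a by ring.
by move=> /eqP.
Qed.

Lemma prism_fvector : fvector (prism_complex r) =
  [:: (12 * r + 3)%N; (84 * r + 3)%N; (144 * r)%N; (72 * r)%N].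
Proof.
have count_eq d : (d < 4)%N -> let: (n, c, f) := nth (0, 0, 0)%N reps_count d in
    (face_count (prism_complex r) d + f * r + c * (2 * r) = c + n * (2 * r))%N.
  move=> d4; have := reps_countP d4; have := sum_orbit_length r2 (face_reps d).
  rewrite -(prism_face_count r2 d4).
  by case: (nth _ _ _) => -[n c] f + [<- <- <-].
rewrite /fvector -[iota 0 4]/[:: 0; 1; 2; 3]%N !map_cons [map _ [::]]/=.
have e0 : (face_count (prism_complex r) 0 + 2 * r + 3 * (2 * r) = 3 + 10 * (2 *
    r))%N.
  exact: (count_eq 0 isT).
have e1 : (face_count (prism_complex r) 1 + 2 * r + 3 * (2 * r) = 3 + 46 * (2 *
    r))%N.
  exact: (count_eq 1 isT).
have e2 : (face_count (prism_complex r) 2 + 4 * r + 0 * (2 * r) = 0 + 74 * (2 *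
    r))%N.
  exact: (count_eq 2 isT).
have e3 : (face_count (prism_complex r) 3 + 0 * r + 0 * (2 * r) = 0 + 36 * (2 *
    r))%N.
  exact: (count_eq 3 isT).
by congr [:: _; _; _; _]; [move: e0|move: e1|move: e2|move: e3]; clear; lia.
Qed.

End Action.

Local Close Scope classical_set_scope.

(** * The homeomorphism *)

Local Open Scope classical_set_scope.

Section Homeomorphism.
Variables (R : realType) (r : nat).
Hypothesis r2 : (2 <= r)%N.
Local Notation Zn := 'Z_(2 * r).
Local Notation zn k := (Z.of_nat (nat_of_ord k)).
Local Notation K := (prism_complex r).
Local Notation X := (realization R K).
Local Notation index := ('I_(size tets) * Zn)%type.
Local Notation tet j := (nth [::] tets j).
Implicit Types (j : index) (p : X).

Lemma tet_in j : tet j.1 \in tets. Proof. exact: mem_nth. Qed.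

Definition supported j p : Prop :=
  forall v, v \notin face (tet j.1) j.2 -> \val p v = 0.

(** On one closed simplex this inverts [push], since labels are injective on a tetrahedron. *)
Definition pull j p : 'I_25 -> R :=
  fun i => if (i : nat) \in tet j.1 then \val p (label i j.2) else 0.

Lemma realizationP p : [/\ forall v, 0 <= \val p v, \sum_v \val p v = 1 &
  [set v | \val p v != 0]%SET \in K].
Proof. exact: (set_mem (valP p)). Qed.

Lemma supported_exists p : exists j, supported j p.
Proof.
have [_ _ /prism_complexP[_ [A [k [At sA]]]]] := realizationP p.
have iA : (seq.index A tets < size tets)%N by rewrite index_mem.
exists (Ordinal iA, k) => v; rewrite /= nth_index// => vA.
apply/eqP; apply: contraNT vA => pv; apply: (fintype.subsetP sA).
by rewrite finset.inE.
Qed.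

Lemma pull_push j p : supported j p -> push (pull j p) j.2 =1 \val p.
Proof.
move=> sp v; rewrite /push /pull; have At := tet_in j.
have [vA|vA] := boolP (v \in face (tet j.1) j.2); last first.
  rewrite sp// big1// => i /eqP iv; case: ifP => // iA.
  by rewrite sp// iv.
move: vA; rewrite mem_face => /mapP[i iA ->].
have [_ _ /allP A25 _ _] := tet_facts R At.
rewrite (bigD1 (Ordinal (A25 _ iA)))//= iA big1 ?addr0// => l /andP[/eqP le li].
case: ifP => // lA; case/eqP: li; apply: val_inj => /=.
exact: (label_tet_inj r2 At lA iA le).
Qed.

Lemma pull_weights j p : supported j p -> weights (tet j.1) (pull j p).
Proof.
move=> sp; have [p0 p1 _] := realizationP p; split.
- by move=> i; rewrite /pull; case: ifP.
- rewrite -p1 (partition_big (fun i : 'I_25 => label i j.2) xpredT)//=.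
  by apply: eq_bigr => v _; exact: pull_push.
- by move=> i; rewrite /pull; case: ifP => //; rewrite eqxx.
Qed.

Definition chart_at j p : prism_space R r := chart r (bary (pull j p)) (zr R
    (zn j.2)).

Definition choose_index p : index := sval (cid (supported_exists p)).

Lemma choose_indexP p : supported (choose_index p) p.
Proof. exact: (svalP (cid (supported_exists p))). Qed.

Definition prism_map p : prism_space R r := chart_at (choose_index p) p.

(** By [chart_push] the chosen index does not matter: any weights representing p compute the map. *)
Lemma prism_map_push A w (k : Zn) p : A \in tets -> weights A w ->
  push w k =1 \val p -> prism_map p = chart r (bary w) (zr R (zn k)).
Proof.
move=> At wA wp; have sp := @choose_indexP p.
apply: (chart_push r2 (tet_in _) At (pull_weights sp) wA) => v.
by rewrite (pull_push sp) wp.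
Qed.

Lemma prism_map_at j p : supported j p -> prism_map p = chart_at j p.
Proof.
move=> sp; exact: (prism_map_push (tet_in j) (pull_weights sp) (pull_push sp)).
Qed.

Lemma push_realization A w (k : Zn) : A \in tets -> weights A w ->
  realization R K (push w k).
Proof.
move=> At wA; have [w0 w1 wAA] := wA; split.
- by move=> v; exact: push_ge0 wA.
- by rewrite -w1 [RHS](partition_big (fun i : 'I_25 => label i k) xpredT).
- apply/prism_complexP; split.
    apply/set0Pn; have [i wi|h] := pickP [pred i | w i != 0].
      by exists (label i k); rewrite finset.inE; exact: push_label wA wi.
    have : \sum_i w i = 0 by apply: big1 => i _; have /negbFE/eqP := h i.
    by rewrite w1 => /eqP; rewrite oner_eq0.
  exists A, k; split=> //; apply/fintype.subsetP => v.
  rewrite finset.inE => /(push_neq0 wA)[i [wi <-]].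
  by rewrite mem_face; apply/mapP; exists (i : nat) => //; exact: wAA.
Qed.

Lemma prism_map_inj : injective prism_map.
Proof.
move=> p q e; have sp := @choose_indexP p; have sq := @choose_indexP q.
apply: val_inj; apply/funext => v.
rewrite -(pull_push sp) -(pull_push sq).
exact: (push_of_chart r2 (tet_in _) (tet_in _) (pull_weights sp) (pull_weights
    sq) e).
Qed.

Lemma prism_map_surj y : exists p, prism_map p = y.
Proof.
have [q <-] : exists q, \pi_(prism_space R r)%qT q = y by exists (repr y);
    exact: reprK.
have [x [k [xc ->]]] := chart_surj r2 q.
have [A [w [At wA <-]]] := cell_covered xc.
pose k0 := zr Zn k.
exists (exist _ (push w k0) (mem_set (push_realization k0 At wA))).
rewrite (prism_map_push At wA (k := k0))//.
by apply: chart_congr => //; rewrite zr_zn.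
Qed.

Lemma pull_continuous j (i : 'I_25) : continuous (fun p => pull j p i).
Proof.
rewrite /pull; have [_|_] := boolP ((i : nat) \in tet j.1).
  exact: evaluation_continuous.
exact: cst_continuous.
Qed.

Lemma lifted_continuous j :
  continuous (fun p => cell_point r (bary (pull j p)) (zr R (zn j.2))).
Proof.
have H (c : Z * Z * Z -> Z) :
    continuous (fun p => \sum_(i < 25) pull j p i * zr R (c (vpos i))).
  by apply: combination_continuous => i; exact: pull_continuous.
apply: point_continuous; [exact: (H coord1)|exact: (H coord2)|exact: (H
    coord3)].
Qed.

Lemma closed_supported_index j : closed (supported j).
Proof. exact: (@closed_supported R _ K (face (tet j.1) j.2)). Qed.

(** The finitely many closed sets [supported j] cover the realization, and on each of them the map
    is a continuous chart. *)
Lemma prism_map_continuous : continuous prism_map.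
Proof.
apply/continuous_closedP => C cC.
have -> : prism_map @^-1` C = \bigcup_(j in [set: index])
    (supported j `&` (chart_at j @^-1` C)).
  apply/seteqP; split=> [p Cp|p [j _ [sp]]].
    by exists (choose_index p) => //; split; [exact: choose_indexP|].
  by rewrite /= (prism_map_at sp).
apply: closed_bigcup; first exact: finite_finset.
move=> j _; apply: closedI; first exact: closed_supported_index.
apply: closed_comp => // p _.
apply: (@continuous_comp _ _ _ (fun p => cell_point r (bary (pull j p)) (zr R
    (zn j.2))) \pi_(prism_space R r)%qT).
  exact: lifted_continuous.
exact: pi_continuous.
Qed.

(** An explicit finite list of the group elements; finiteness is what keeps the union in
    [prism_map_homeomorphism] closed. *)
Definition dstar_rep (n : 'I_(2 * r)) (b : bool) : S3 R :=
  (expi ((n : nat)%:R * unit_angle R r) * (if b then quat_j R else 1))%g.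

Lemma pi_dstar_rep n b q :
  (\pi_(prism_space R r) (dstar_rep n b * q)%g = \pi_(prism_space R r) q)%qT.
Proof.
rewrite /dstar_rep -zr_nat -mulgA pi_expi//.
by case: b; rewrite ?mul1g// pi_quat_j.
Qed.

Lemma expi_turn (m n : Z) :
  expi (zr R (m + n * (2 * Z.of_nat r)) * unit_angle R r) = expi (zr R m *
      unit_angle R r).
Proof.
rewrite zrD turnE mulrDl -full_turn//; apply: val_inj => /=.
by have [-> ->] := cos_sin_period (zr R m * unit_angle R r) n.
Qed.

Lemma dstar_rep_exists (x y : S3 R) :
  (\pi_(prism_space R r) x = \pi_(prism_space R r) y)%qT ->
  exists n b, y = (dstar_rep n b * x)%g.
Proof.
move=> /prism_space_eqP[g /(dstar_gens_form r2)[m gE] ->].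
have r0 : (0 < 2 * Z.of_nat r)%zz by lia.
have [c mb] : exists c : Z, (0 <= m - c * (2 * Z.of_nat r) < 2 * Z.of_nat r)%zz.
  exists (m / (2 * Z.of_nat r))%zz; rewrite Z.mul_comm -Z.mod_eq; last by lia.
  exact: Z.mod_pos_bound.
have nl : (Z.to_nat (m - c * (2 * Z.of_nat r)) < 2 * r)%N by lia.
have mE : expi (zr R m * unit_angle R r) = expi ((Ordinal nl : nat)%:R *
    unit_angle R r).
  have e : Z.of_nat (Z.to_nat (m - c * (2 * Z.of_nat r))) = (m - c * (2 *
      Z.of_nat r))%zz.
    by apply: Z2Nat.id; case: mb.
  rewrite -zr_nat [Z.of_nat _]e.
  by rewrite -(expi_turn (m - c * (2 * Z.of_nat r)) c) Z.sub_add.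
by exists (Ordinal nl); case: gE => ->; [exists false|exists true]; rewrite
    /dstar_rep -mE ?mulg1.
Qed.

Lemma prism_map_homeomorphism : homeomorphism prism_map.
Proof.
have [g gK] := choice prism_map_surj.
have Kg : cancel prism_map g by move=> p; apply: prism_map_inj; rewrite gK.
exists g; split=> //; first exact: prism_map_continuous.
apply/quotient_continuous/continuous_closedP => C cC.
pose f (u : index * ('I_(2 * r) * bool)) p : S3 R :=
  (dstar_rep u.2.1 u.2.2 * cell_point r (bary (pull u.1 p)) (zr R (zn
      u.1.2)))%g.
(* Lifted to the sphere, the preimage is a finite union of group translates of compact images,
   closed because the sphere is Hausdorff. *)
have -> : (g \o \pi_(prism_space R r)%qT) @^-1` C =
    \bigcup_(u in [set: index * ('I_(2 * r) * bool)]) (f u @` (C `&` supported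
        u.1)).
  apply/seteqP; split=> [q Cq|q [u _ [p [Cp sp] <-]]].
    set p := g (\pi_(prism_space R r)%qT q) in Cq.
    have sp := @choose_indexP p.
    have e : (\pi_(prism_space R r) (cell_point r (bary (pull (choose_index p)
        p))
        (zr R (zn (choose_index p).2))) = \pi_(prism_space R r) q)%qT.
      by rewrite -[RHS]gK.
    have [n [b qE]] := dstar_rep_exists e.
    by exists (choose_index p, (n, b)) => //; exists p.
  rewrite /= /f pi_dstar_rep.
  have <- : prism_map p = \pi_(prism_space R r)%qT (cell_point r (bary (pull
      u.1 p)) (zr R (zn u.1.2))).
    exact: prism_map_at.
  by rewrite Kg.
apply: closed_bigcup; first exact: finite_finset.
move=> u _; apply: compact_closed; first exact: S3_hausdorff.
apply: continuous_compact.
  apply: continuous_subspaceT => p.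
  apply: (@continuous_comp _ _ _ (fun p => cell_point r (bary (pull u.1 p)) (zr
      R (zn u.1.2)))
    (fun q => (dstar_rep u.2.1 u.2.2 * q)%g)); first exact: lifted_continuous.
  exact: lmul_continuous.
apply: (subclosed_compact _ (realization_compact _)) => //.
- apply: closedI => //; exact: closed_supported_index.
- by have [] := @prism_simplicial_complex r.
Qed.

(** The weights representing p in the translate k represent q in the translate [k + a], and each
    rotation adds 1 to that index. *)
Lemma prism_map_equivariant (a : Zn) p q : vertex_image (fun v => turn_action r
    v a) p q ->
  prism_map q = iter a (@prism_rotation R r) (prism_map p).
Proof.
move=> pq; pose j := choose_index p; have sp : supported j p := @choose_indexP
    p.
have wA := pull_weights sp.
rewrite (prism_map_at sp) /chart_at.
have -> : prism_map q = chart r (bary (pull j p)) (zr R (zn (j.2 + a))).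
  apply: (prism_map_push (tet_in j) wA) => v.
  rewrite -[v](actKV (turn_action r) a) pq -(pull_push sp) !pushE.
  apply: eq_bigr => i _; congr (_ * _%:R).
  by rewrite -turn_label (inj_eq (act_inj (turn_action r) a)).
have it n k : iter n (@prism_rotation R r) (chart r (bary (pull j p)) k) =
    chart r (bary (pull j p)) (k + n%:R).
  elim: n => [|n IHn]; first by rewrite addr0.
  by rewrite iterS IHn chart_rotation// -natr1 addrA.
rewrite it -zr_nat -zrD; apply: chart_congr => //.
by rewrite zrD !zr_zn.
Qed.

End Homeomorphism.

Theorem theorem15 (R : realType) (r : nat) (hr : (2 <= r)%N) :
  exists (V : finType) (K : {set {set V}})
    (to : {action 'Z_(2 * r) &-> V})
    (h : realization R K -> prism_space R r),
  [/\ simplicial_complex K /\ homeomorphism h,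
      simplicial_action K to,
      effective_action to,
      forall (a : 'Z_(2 * r)) (p q : realization R K),
        vertex_image (fun v => to v a) p q ->
        h q = iter a (@prism_rotation R r) (h p) &
      fvector K =
        [:: (12 * r + 3)%N; (84 * r + 3)%N; (144 * r)%N; (72 * r)%N]].
Proof.
exists (vertex r), (prism_complex r), (turn_action r), (@prism_map R r).
split.
- by split; [exact: prism_simplicial_complex|exact: prism_map_homeomorphism].
- exact: turn_simplicial.
- exact: turn_effective.
- exact: prism_map_equivariant.
- exact: prism_fvector.
Qed.
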